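(* Let $\alpha>0$, $R>0$, $\Omega=B(0,R)\subset\mathbb R^2$, and suppose $u\in H^3(\Omega)$ satisfies $\Delta u=\alpha^2u$ in $\Omega$. Then $$\|u\|_{H^2(\Omega)}^2\le C_3\left\{\left\|\frac{\partial u}{\partial n}\right\|_{L^2(\partial\Omega)}^2+\left\|\frac{\partial u_x}{\partial n}\right\|_{L^2(\partial\Omega)}^2+\left\|\frac{\partial u_y}{\partial n}\right\|_{L^2(\partial\Omega)}^2\right\},$$ where $C_3:=C_\Omega^2/C_2^2$, $C_2:=\min\{1,\alpha^2\}$ and $C_\Omega:=1+2/R$.
   Context: $B(0,R)$ is the disk of radius $R$ centred at the origin; points of $\mathbb R^2$ are written $(x,y)$ and $u_x,u_y$ are partial derivatives. $u$ is real-valued. Norm: $\|u\|_{H^2(\Omega)}^2=\|u_{xx}\|_{L^2(\Omega)}^2+\|u_{yy}\|_{L^2(\Omega)}^2+\|u_{xy}\|_{L^2(\Omega)}^2+\|\nabla u\|_{L^2(\Omega)}^2+\|u\|_{L^2(\Omega)}^2$. $\partial/\partial n$ is the outward normal derivative on $\partial\Omega$ (in the trace sense); $L^2(\partial\Omega)$ is taken with respect to arc length. *)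

(* Defs.v *)
From HB Require Import structures.
From mathcomp Require Import all_boot all_order all_algebra.
From mathcomp Require Import all_classical all_reals all_analysis.
Set Implicit Arguments.
Unset Strict Implicit.
Unset Printing Implicit Defensive.
Import Order.TTheory GRing.Theory Num.Theory.
Import numFieldNormedType.Exports.
Local Open Scope classical_set_scope.
Local Open Scope ring_scope.

(* The plane is [R * R].  Its library norm is the sup norm, so the Euclidean
   disk is not [ball 0 r]; the topology, and hence smoothness, is unaffected. *)
Definition disk (R : realType) (r : R) : set (R * R) :=
  [set p | p.1 ^+ 2 + p.2 ^+ 2 < r ^+ 2].

Definition circle (R : realType) (r : R) (t : R) : R * R :=
  (r * cos t, r * sin t).

Definition leb2 (R : realType) :
    {measure set (measurableTypeR R * measurableTypeR R) -> \bar R} :=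
  (@lebesgue_measure R \x @lebesgue_measure R)%E.
Arguments leb2 : clear implicits.

Inductive axis : Type := ax_x | ax_y.

Definition axis_vec (R : realType) (a : axis) : R * R :=
  match a with ax_x => (1, 0) | ax_y => (0, 1) end.
Arguments axis_vec : clear implicits.

(* [partial [:: a1; ..; ak] f] is D_a1 (.. (D_ak f)). *)
Definition partial (R : realType) (s : seq axis) (f : R * R -> R) :
  R * R -> R :=
  foldr (fun a (g : R * R -> R) (p : R * R) => 'D_(axis_vec R a) g p) f s.

(* C^oo on the whole plane: all iterated partials exist and are continuous. *)
Definition smooth (R : realType) (f : R * R -> R) : Prop :=
  forall s : seq axis, continuous (partial s f) /\
    forall (a : axis) (p : R * R), derivable (partial s f) p (axis_vec R a).

Definition test_function (R : realType) (U : set (R * R)) (f : R * R -> R) :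
  Prop :=
  [/\ smooth f, compact (closure [set p | f p != 0])
    & closure [set p | f p != 0] `<=` U].

Definition L2sq (R : realType) (U : set (R * R)) (f : R * R -> R) : \bar R :=
  (\int[leb2 R]_(p in U) ((f p) ^+ 2)%:E)%E.

(* Members of L^2(U) are represented by Borel functions; values off U are
   irrelevant. *)
Definition inL2 (R : realType) (U : set (R * R)) (f : R * R -> R) : Prop :=
  measurable_fun U f /\ (L2sq U f < +oo)%E.

(* L^2 of the circle of radius r: arc length is r dt under [circle r]. *)
Definition bL2sq (R : realType) (r : R) (g : R * R -> R) : \bar R :=
  (r%:E * \int[lebesgue_measure]_(t in `[0%R, (2 * pi)%R])
            ((g (circle r t)) ^+ 2)%:E)%E.

Definition inbL2 (R : realType) (r : R) (g : R * R -> R) : Prop :=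
  measurable_fun `[0, 2 * pi] (g \o circle r) /\ (bL2sq r g < +oo)%E.

Definition is_weak_partial (R : realType) (U : set (R * R)) (s : seq axis)
    (u v : R * R -> R) : Prop :=
  forall phi, test_function U phi ->
    \int[leb2 R]_(p in U) (u p * partial s phi p) =
    (-1) ^+ size s * \int[leb2 R]_(p in U) (v p * phi p).

Definition sobolev (R : realType) (U : set (R * R)) (k : nat)
    (u : R * R -> R) : Prop :=
  inL2 U u /\ forall s : seq axis, (size s <= k)%N ->
    exists v, inL2 U v /\ is_weak_partial U s u v.

(* A representative of the weak derivative, unique a.e. on U when it exists. *)
Definition wpartial (R : realType) (U : set (R * R)) (s : seq axis)
    (u : R * R -> R) : R * R -> R :=
  xget (cst 0) [set v | inL2 U v /\ is_weak_partial U s u v].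

Definition H2sq (R : realType) (U : set (R * R)) (u : R * R -> R) : \bar R :=
  (L2sq U (wpartial U [:: ax_x; ax_x] u)
   + L2sq U (wpartial U [:: ax_y; ax_y] u)
   + L2sq U (wpartial U [:: ax_x; ax_y] u)
   + (L2sq U (wpartial U [:: ax_x] u) + L2sq U (wpartial U [:: ax_y] u))
   + L2sq U u)%E.

(* The trace operator H^1(disk) -> L^2(circle) as a relation: the continuous
   extension of restriction to the circle from functions smooth up to the
   boundary.  Every w in H^1 has a trace g, unique a.e. on the circle. *)
Definition is_trace (R : realType) (r : R) (w g : R * R -> R) : Prop :=
  [/\ sobolev (disk r) 1 w, inbL2 r g &
   exists phi : nat -> R * R -> R,
     [/\ forall n, smooth (phi n),
         L2sq (disk r) (phi n \- w) @[n --> \oo] --> 0%E,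
         forall a : axis,
           L2sq (disk r) (partial [:: a] (phi n) \- wpartial (disk r) [:: a] w)
             @[n --> \oo] --> 0%E
       & bL2sq r (phi n \- g) @[n --> \oo] --> 0%E]].

(* g is the normal derivative of w in the trace sense: n . trace(grad w), the
   outward unit normal at p being p / r. *)
Definition is_normal_derivative (R : realType) (r : R) (w g : R * R -> R) :
  Prop :=
  exists gx gy : R * R -> R,
    [/\ is_trace r (wpartial (disk r) [:: ax_x] w) gx,
        is_trace r (wpartial (disk r) [:: ax_y] w) gy
      & forall p : R * R, p.1 ^+ 2 + p.2 ^+ 2 = r ^+ 2 ->
          g p = gx p * (p.1 / r) + gy p * (p.2 / r)].

(* Laplace u = a^2 u in U. *)
Definition helmholtz (R : realType) (U : set (R * R)) (a : R)
    (u : R * R -> R) : Prop :=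
  {ae leb2 R, forall p, U p ->
     wpartial U [:: ax_x; ax_x] u p + wpartial U [:: ax_y; ax_y] u p
     = a ^+ 2 * u p}.

Definition C_2 (R : realType) (a : R) : R := Num.min 1 (a ^+ 2).
Definition C_Omega (R : realType) (r : R) : R := 1 + 2 / r.
Definition C_3 (R : realType) (a r : R) : R := C_Omega r ^+ 2 / C_2 a ^+ 2.

(* Main.v *)
Require Import Defs.
From mathcomp Require Import all_boot all_order all_algebra.
From mathcomp Require Import all_classical all_reals all_analysis.
From mathcomp Require Import measurable_realfun unstable ring lra.
Import Order.TTheory GRing.Theory Num.Theory.
Import numFieldNormedType.Exports.
Set Implicit Arguments.
Unset Strict Implicit.
Unset Printing Implicit Defensive.
Local Open Scope classical_set_scope.
Local Open Scope ring_scope.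

(** Let [w] be one of u, u_x, u_y.  Each solves Laplace w = alpha^2 w, so
    multiplying by [w] and integrating by parts gives the energy identity

      |grad w|^2 + alpha^2 |w|^2 = int_circle w dw/dn.

    Summed over the three functions, the left side is at least C_2 S, where S is
    the sum of the three squared H^1 norms, and S dominates the squared H^2 norm
    of u.  On the right, Young's inequality separates the normal derivatives from
    the traces of [w], and the trace inequality

      int_circle w^2 <= (1 + 2/r) (|w|^2 + |grad w|^2),

    which is the divergence theorem for the field w^2 (x, y), lets half of the
    left side absorb the latter.  The identity is [energy_identity], the trace
    inequality is [trace_traced], and [energy_bound] combines them by means of
    [absorption_bound].

    Both facts rest on the divergence theorem on the disk for functions that are
    smooth on the plane ([divergence_x], [divergence_y]): Fubini, the fundamental
    theorem of calculus on chords, and the parametrisation y = r sin t of the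
    boundary.  They pass to the functions at hand because having a trace means
    being a limit of smooth functions, in H^1 of the disk and in L^2 of the circle.

    Three points are specific to weak derivatives.  First, normal derivatives of
    u, u_x, u_y provide traces of the first and second derivatives of u, but none
    of u; since u = alpha^-2 (u_xx + u_yy), the approximants of the second
    derivatives also yield approximants of u, with a trace
    ([weak_partial_recovery]).  Second, u_x and u_y have to satisfy the equation
    in the strong sense; derivatives are moved to test functions, where they
    commute ([weak_laplacian_partial], [derive_commute]).  Third, both arguments
    only yield equalities against test functions.  All functions involved are L^2
    limits of smooth functions, and such a function vanishes when it is weakly
    null: test it with its own approximants, cut off near the circle
    ([weakly_null_null]).  The cutoffs are built from exp(-1/s). *)

(** * Square-integrable functions *)

Lemma eq_cvg_fun {R : realType} (u v : nat -> R) (l : R) : u =1 v ->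
  u n @[n --> \oo] --> l -> v n @[n --> \oo] --> l.
Proof. by move=> /funext ->. Qed.

Lemma cvg_add {R : realType} (u v : nat -> R) (a b : R) :
  u n @[n --> \oo] --> a -> v n @[n --> \oo] --> b ->
  u n + v n @[n --> \oo] --> a + b.
Proof. by move=> ua vb; exact: cvgD. Qed.

Lemma cvg_scale {R : realType} (c : R) (u : nat -> R) (a : R) :
  u n @[n --> \oo] --> a -> c * u n @[n --> \oo] --> c * a.
Proof. by move=> ua; exact: cvgMl_tmp. Qed.

Section SquareIntegrable.
Context {d} {T : measurableType d} {R : realType}.
Variables (mu : {measure set T -> \bar R}) (D : set T).
Hypothesis mD : measurable D.

Definition sqint (f : T -> R) : Prop :=
  measurable_fun D f /\ (\int[mu]_(x in D) ((f x) ^+ 2)%:E < +oo)%E.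

Definition ip (f g : T -> R) : R := \int[mu]_(x in D) (f x * g x).

Lemma sqint_integrable f : sqint f ->
  mu.-integrable D (EFin \o (fun x => f x * f x)).
Proof.
move=> [mf fo]; apply/integrableP; split.
  by apply/measurable_EFinP; exact: measurable_funM.
congr (_ < _)%E: fo; apply: eq_integral => x _ /=.
by rewrite -expr2 ger0_norm ?sqr_ge0.
Qed.

Lemma sqint_mul_integrable f g : sqint f -> sqint g ->
  mu.-integrable D (EFin \o (fun x => f x * g x)).
Proof.
move=> sf sg.
have h := integrableD mD (sqint_integrable sf) (sqint_integrable sg).
apply: (le_integrable mD _ _ h).
  by apply/measurable_EFinP; apply: measurable_funM; [case: sf|case: sg].
move=> x _ /=; rewrite lee_fin normrM.
rewrite [leRHS]ger0_norm ?addr_ge0 -?expr2 ?sqr_ge0//.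
rewrite -(real_normK (num_real (f x))) -(real_normK (num_real (g x))).
have := sqr_ge0 (`|f x| - `|g x|).
by have := sqr_ge0 (`|f x| + `|g x|); nra.
Qed.

Lemma sqintE f : sqint f ->
  (\int[mu]_(x in D) ((f x) ^+ 2)%:E)%E = (ip f f)%:E.
Proof.
move=> sf; rewrite /ip /Rintegral fineK //.
exact: (integrable_fin_num mD (sqint_integrable sf)).
Qed.

Lemma ipC f g : ip f g = ip g f.
Proof. by apply: eq_Rintegral => x _; rewrite mulrC. Qed.

Lemma eq_ip f f' g : {in D, f =1 f'} -> ip f g = ip f' g.
Proof. by move=> ff'; apply: eq_Rintegral => x xD; rewrite ff'. Qed.

Lemma ipDl f g h : sqint f -> sqint g -> sqint h ->
  ip (fun x => f x + g x) h = ip f h + ip g h.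
Proof.
move=> sf sg sh; rewrite /ip -RintegralD //; try exact: sqint_mul_integrable.
by apply: eq_Rintegral => x _; rewrite mulrDl.
Qed.

Lemma ipZl c f h : sqint f -> sqint h ->
  ip (fun x => c * f x) h = c * ip f h.
Proof.
move=> sf sh; rewrite /ip -RintegralZl //; last exact: sqint_mul_integrable.
by apply: eq_Rintegral => x _; rewrite mulrA.
Qed.

Lemma ip_ge0 f : 0 <= ip f f.
Proof. by apply: Rintegral_ge0 => x _; rewrite -expr2 sqr_ge0. Qed.

Lemma sqint_of_integrable (f : T -> R) : measurable_fun D f ->
  mu.-integrable D (EFin \o (fun x => f x * f x)) -> sqint f.
Proof.
by move=> mf fi; split => //; exact: (integrable_lty mD fi).
Qed.

Lemma sqintD f g : sqint f -> sqint g -> sqint (fun x => f x + g x).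
Proof.
move=> sf sg; have [mf _] := sf; have [mg _] := sg.
have mfg : measurable_fun D (fun x => f x + g x) by exact: measurable_funD.
apply: sqint_of_integrable => //.
have h := integrableD mD
  (integrableD mD (sqint_integrable sf) (sqint_integrable sg))
  (integrableD mD (sqint_mul_integrable sf sg) (sqint_mul_integrable sf sg)).
apply: (le_integrable mD _ _ h).
  by apply/measurable_EFinP; exact: measurable_funM.
move=> x _ /=; rewrite lee_fin le_eqVlt; apply/orP; left; apply/eqP.
by congr `|_|; ring.
Qed.

Lemma sqintZ c f : sqint f -> sqint (fun x => c * f x).
Proof.
move=> sf; have [mf _] := sf.
have mcf : measurable_fun D (fun x => c * f x).
  by apply: measurable_funM => //; exact: measurable_cst.
apply: sqint_of_integrable => //.
have := integrableZl mD (c * c) (sqint_integrable sf).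
apply: eq_integrable => // x _ /=.
by rewrite -EFinM; congr EFin; ring.
Qed.

Lemma sqintB f g : sqint f -> sqint g -> sqint (fun x => f x - g x).
Proof.
move=> sf sg; have := sqintD sf (sqintZ (-1) sg).
by congr sqint; apply/funext => x; rewrite mulN1r.
Qed.

Lemma ipBl f g h : sqint f -> sqint g -> sqint h ->
  ip (fun x => f x - g x) h = ip f h - ip g h.
Proof.
move=> sf sg sh; rewrite -mulN1r -ipZl// -ipDl//; last exact: sqintZ.
by apply: eq_ip => x _; rewrite mulN1r.
Qed.

Lemma ip_expand c f g : sqint f -> sqint g ->
  ip (fun x => f x + c * g x) (fun x => f x + c * g x) =
  ip f f + c * ip f g *+ 2 + c ^+ 2 * ip g g.
Proof.
move=> sf sg; have scg := sqintZ c sg; have sfg := sqintD sf scg.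
rewrite ipDl// ipZl// (ipC f) (ipC g) ipDl// ipZl// ipDl// ipZl//.
by rewrite (ipC g f); ring.
Qed.

Lemma ip_cauchy_schwarz f g : sqint f -> sqint g ->
  (ip f g) ^+ 2 <= ip f f * ip g g.
Proof.
move=> sf sg.
have h c : 0 <= ip f f + c * ip f g *+ 2 + c ^+ 2 * ip g g.
  by rewrite -ip_expand// ip_ge0.
have f0 := ip_ge0 f.
have [ge0|gn0] := eqVneq (ip g g) 0.
  have [->|bn0] := eqVneq (ip f g) 0; first by rewrite expr0n ge0 mulr0.
  have := h (- (ip f f + 1) / ip f g).
  rewrite ge0 mulr0 addr0 divfK//; lra.
have gp : 0 < ip g g by rewrite lt0r gn0 ip_ge0.
have := h (- (ip f g / ip g g)).
rewrite -(pmulr_lge0 _ gp).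
have -> : (ip f f + - (ip f g / ip g g) * ip f g *+ 2 +
  (- (ip f g / ip g g)) ^+ 2 * ip g g) * ip g g
  = ip f f * ip g g - ip f g ^+ 2 by field.
by rewrite subr_ge0.
Qed.

(** Cauchy-Schwarz: the factor [a n] stays bounded in norm while [b n] vanishes. *)
Lemma ip_bound_cvg0 (a b : nat -> T -> R) (M : R) :
  (forall n, sqint (a n)) -> (forall n, sqint (b n)) ->
  (\forall n \near \oo, ip (a n) (a n) <= M) ->
  ip (b n) (b n) @[n --> \oo] --> 0 ->
  ip (a n) (b n) @[n --> \oo] --> 0.
Proof.
move=> sa sb aM bn0.
have h : (ip (a n) (b n)) ^+ 2 @[n --> \oo] --> 0.
  apply: (@squeeze_cvgr _ \oo _ _ (fun=> 0) (fun n => M * ip (b n) (b n))).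
  - near=> n; rewrite sqr_ge0/=.
    apply: le_trans (ip_cauchy_schwarz (sa n) (sb n)) _.
    by apply: ler_wpM2r; [exact: ip_ge0|near: n].
  - exact: cvg_cst.
  - by rewrite -[X in _ --> X](mulr0 M); exact: cvgMl_tmp.
apply/cvgrPdist_lt => e e0; move/cvgrPdist_lt : h => /(_ (e ^+ 2)).
rewrite exprn_gt0// => /(_ isT); apply: filterS => n.
rewrite !sub0r !normrN normrX ltr_pXn2r// nnegrE//; exact: ltW.
Unshelve. all: by end_near. Qed.

Definition sqcvg (a : nat -> T -> R) (f : T -> R) : Prop :=
  ip (fun x => a n x - f x) (fun x => a n x - f x) @[n --> \oo] --> 0.

(** Expand around the limits: each of the three error terms pairs a bounded
    factor with a vanishing one. *)
Lemma ip_cvg (a b : nat -> T -> R) (f g : T -> R) :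
  (forall n, sqint (a n)) -> (forall n, sqint (b n)) -> sqint f -> sqint g ->
  sqcvg a f -> sqcvg b g -> ip (a n) (b n) @[n --> \oo] --> ip f g.
Proof.
move=> sa sb sf sg af bg.
have saf n : sqint (fun x => a n x - f x) by exact: sqintB.
have sbg n : sqint (fun x => b n x - g x) by exact: sqintB.
have h1 : ip f (fun x => b n x - g x) @[n --> \oo] --> 0.
  by apply: (@ip_bound_cvg0 (fun=> f) _ (ip f f)) => //; near=> n.
have h2 : ip g (fun x => a n x - f x) @[n --> \oo] --> 0.
  by apply: (@ip_bound_cvg0 (fun=> g) _ (ip g g)) => //; near=> n.
have h3 : ip (fun x => a n x - f x) (fun x => b n x - g x) @[n --> \oo] --> 0.
  apply: (@ip_bound_cvg0 (fun n x => a n x - f x)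
    (fun n x => b n x - g x) 1) => //.
  by apply: filterS (cvgr_lt 0 af _ ltr01) => n /ltW.
have h4 : (fun _ : nat => ip f g) n @[n --> \oo] --> ip f g by exact: cvg_cst.
have := cvg_add (cvg_add (cvg_add h1 h2) h3) h4.
rewrite !add0r; move=> h; refine (eq_cvg_fun _ h) => n /=.
rewrite !ipBl// [ip (a n) _]ipC [ip f (fun _ => _)]ipC [ip g (fun _ => _)]ipC.
rewrite !ipBl// (ipC g f) (ipC (b n)) (ipC g (a n)) (ipC (b n)); ring.
Unshelve. all: by end_near. Qed.

Lemma sqcvgD (a b : nat -> T -> R) (f g : T -> R) :
  (forall n, sqint (a n)) -> (forall n, sqint (b n)) -> sqint f -> sqint g ->
  sqcvg a f -> sqcvg b g ->
  sqcvg (fun n x => a n x + b n x) (fun x => f x + g x).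
Proof.
move=> sa sb sf sg af bg.
have saf n : sqint (fun x => a n x - f x) by exact: sqintB.
have sbg n : sqint (fun x => b n x - g x) by exact: sqintB.
have h3 : ip (fun x => a n x - f x) (fun x => b n x - g x) @[n --> \oo] --> 0.
  apply: (@ip_bound_cvg0 (fun n x => a n x - f x)
    (fun n x => b n x - g x) 1) => //.
  by apply: filterS (cvgr_lt 0 af _ ltr01) => n /ltW.
have := cvg_add (cvg_add (cvg_add af h3) h3) bg; rewrite !addr0.
move=> h; refine (eq_cvg_fun _ h) => n /=.
have -> : (fun x => a n x + b n x - (f x + g x)) =
  (fun x => (a n x - f x) + 1 * (b n x - g x)).
  by apply/funext => x; ring.
by rewrite ip_expand//; ring.
Qed.

Lemma sqcvgZ c (a : nat -> T -> R) (f : T -> R) :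
  (forall n, sqint (a n)) -> sqint f -> sqcvg a f ->
  sqcvg (fun n x => c * a n x) (fun x => c * f x).
Proof.
move=> sa sf af.
have saf n : sqint (fun x => a n x - f x) by exact: sqintB.
have := @cvg_scale _ (c * c) _ _ af; rewrite mulr0.
move=> h; refine (eq_cvg_fun _ h) => n /=.
have -> : (fun x => c * a n x - c * f x) = (fun x => c * (a n x - f x)).
  by apply/funext => x; ring.
by rewrite ipZl// 1?ipC ?ipZl//; [ring|exact: sqintZ].
Qed.

End SquareIntegrable.

Section BoundedMultiplier.
Context {d} {T : measurableType d} {R : realType}.
Variables (mu : {measure set T -> \bar R}) (D : set T).
Hypothesis mD : measurable D.
Variable m : T -> R.
Hypotheses (mm : measurable_fun D m) (m1 : forall x, `|m x| <= 1).

Lemma sqr_mul_le (f : T -> R) x : (f x * m x) * (f x * m x) <= f x * f x.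
Proof.
rewrite -!expr2 exprMn ler_piMr ?sqr_ge0//.
by rewrite -(real_normK (num_real (m x))) expr_le1.
Qed.

Lemma sqint_mul f : sqint mu D f -> sqint mu D (fun x => f x * m x).
Proof.
move=> sf; have [mf _] := sf.
have mfm : measurable_fun D (fun x => f x * m x) by exact: measurable_funM.
apply: sqint_of_integrable => //.
apply: (le_integrable mD _ _ (sqint_integrable sf)).
  by apply/measurable_EFinP; exact: measurable_funM.
move=> x _; rewrite /= lee_fin [leLHS]ger0_norm -?expr2 ?sqr_ge0//.
by rewrite [leRHS]ger0_norm -?expr2 ?sqr_ge0// !expr2; exact: sqr_mul_le.
Qed.

Lemma ip_mul_le f : sqint mu D f ->
  ip mu D (fun x => f x * m x) (fun x => f x * m x) <= ip mu D f f.
Proof.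
move=> sf; apply: le_Rintegral => //.
- exact: sqint_integrable (sqint_mul sf).
- exact: sqint_integrable.
- by move=> x _; exact: sqr_mul_le.
Qed.

(** Used for the factors cos and sin of the unit normal. *)
Lemma sqcvg_mul (a : nat -> T -> R) (f : T -> R) :
  (forall n, sqint mu D (a n)) -> sqint mu D f -> sqcvg mu D a f ->
  sqcvg mu D (fun n x => a n x * m x) (fun x => f x * m x).
Proof.
move=> sa sf af.
apply: (@squeeze_cvgr _ \oo _ _ (fun=> 0)
  (fun n => ip mu D (fun x => a n x - f x) (fun x => a n x - f x))) => //.
  near=> n; rewrite ip_ge0/=.
  have -> : (fun x => a n x * m x - f x * m x) =
      (fun x => (a n x - f x) * m x) by apply/funext => x; rewrite mulrBl.
  by apply: ip_mul_le; exact: sqintB.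
exact: cvg_cst.
Unshelve. all: by end_near. Qed.

End BoundedMultiplier.

Section NullDifference.
Context {d} {T : measurableType d} {R : realType}.
Variables (mu : {measure set T -> \bar R}) (D : set T).
Hypothesis mD : measurable D.

(** Equality in L^2, phrased through the inner product so that it transfers to
    inner products by Cauchy-Schwarz, without going back to null sets. *)
Definition sqeq (f g : T -> R) : Prop :=
  ip mu D (fun x => f x - g x) (fun x => f x - g x) = 0.

Lemma ae_imp (P Q : T -> Prop) : (forall x, P x -> Q x) ->
  {ae mu, forall x, P x} -> {ae mu, forall x, Q x}.
Proof. by move=> PQ; apply: filterS. Qed.

Lemma sqeq_refl f : sqeq f f.
Proof.
rewrite /sqeq /ip; under eq_Rintegral do rewrite subrr mulr0.
by rewrite Rintegral_cst// mul0r.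
Qed.

Lemma ip_sqeq f g h : sqint mu D f -> sqint mu D g -> sqint mu D h ->
  sqeq f g -> ip mu D f h = ip mu D g h.
Proof.
move=> sf sg sh fg.
have := ip_cauchy_schwarz mD (sqintB mD sf sg) sh.
rewrite fg mul0r ipBl// => h0.
apply/eqP; rewrite -subr_eq0 -sqrf_eq0 eq_le h0 sqr_ge0//.
Qed.

Lemma ip_sqeq_diag f g : sqint mu D f -> sqint mu D g ->
  sqeq f g -> ip mu D f f = ip mu D g g.
Proof.
by move=> sf sg fg; rewrite (ip_sqeq sf sg sf fg) ipC (ip_sqeq sf sg sg fg).
Qed.

Lemma sqeq_ae f g : sqint mu D f -> sqint mu D g ->
  {ae mu, forall x, D x -> f x = g x} -> sqeq f g.
Proof.
move=> sf sg fg; rewrite /sqeq /ip /Rintegral.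
have sfg := sqintB mD sf sg.
suff -> : (\int[mu]_(x in D) ((f x - g x) * (f x - g x))%:E = 0)%E by [].
rewrite -(integral0 mu D); apply: ae_eq_integral => //.
- exact: measurable_int (sqint_integrable sfg).
- by apply: filterS fg => x h Dx; rewrite h// subrr mulr0.
Qed.

End NullDifference.

(** * Smooth functions of two variables *)

Section SmoothFunctions.
Context {R : realType}.
Implicit Types (f g : R * R -> R) (p v : R * R).

(** Reduces a directional derivative to one real variable, where the chain rule
    and the mean value theorem are available. *)
Lemma is_derive_line f p v (df : R) :
  is_derive p v f df <-> is_derive (0 : R) 1 (fun t : R => f (t *: v + p)) df.
Proof.
have e : (fun h : R => h^-1 *: ((f \o shift p) (h *: v) - f p)) =
  (fun h : R => h^-1 *: (((fun t : R => f (t *: v + p)) \o shift 0) (h *: 1)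
                - f (0 *: v + p))).
  by apply/funext => h /=; rewrite addr0 scale0r add0r [_%:A]mulr1.
split=> -[h1 h2]; apply: DeriveDef.
- by move: h1; rewrite /derivable e.
- by rewrite -h2 /derive e.
- by rewrite /derivable e.
- by rewrite -h2 /derive e.
Qed.

Lemma is_derive_comp1 (F : R -> R) f p v (dF df : R) :
  is_derive (f p) 1 F dF -> is_derive p v f df ->
  is_derive p v (F \o f) (dF * df).
Proof.
move=> hF /is_derive_line hf; apply/is_derive_line.
apply: (@is_derive1_comp _ F (fun t : R => f (t *: v + p))) => //.
by rewrite scale0r add0r.
Qed.

Lemma is_derive_fst p v : is_derive p v (fun q : R * R => q.1) v.1.
Proof.
apply/is_derive_line.
have -> : (fun t : R => (t *: v + p).1) = (fun t => t * v.1 + p.1) by [].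
apply: is_derive_eq; rewrite ?scaler0 ?addr0 ?add0r.
exact: mulr1.
Qed.

Lemma is_derive_snd p v : is_derive p v (fun q : R * R => q.2) v.2.
Proof.
apply/is_derive_line.
have -> : (fun t : R => (t *: v + p).2) = (fun t => t * v.2 + p.2) by [].
apply: is_derive_eq; rewrite ?scaler0 ?addr0 ?add0r.
exact: mulr1.
Qed.

(** Recursion on the order rather than on words of axes: with this form the
    product rule gives stability under products by a direct induction. *)
Fixpoint Cn (n : nat) f : Prop :=
  continuous f /\
  if n is m.+1 then forall a : axis,
    (forall p, derivable f p (axis_vec R a)) /\ Cn m (partial [:: a] f)
  else True.

Lemma CnW n f : Cn n.+1 f -> Cn n f.
Proof.
elim: n f => [|n IH] f; first by case.
by case=> cf h; split=> // a; have [df /IH] := h a.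
Qed.

(** The innermost derivative of a word can be peeled off, which is the one that
    the recursion in [Cn] takes first. *)
Lemma partial_rcons (s : seq axis) (a : axis) f :
  partial (rcons s a) f = partial s (partial [:: a] f).
Proof. by rewrite /partial foldr_rcons. Qed.

Lemma smooth_partial f a : smooth f -> smooth (partial [:: a] f).
Proof. by move=> sf s; rewrite -partial_rcons; exact: sf. Qed.

Lemma smoothP f : smooth f <-> forall n, Cn n f.
Proof.
split=> [sf n|].
  elim: n f sf => [|n IH] f sf; first by split=> //; have [] := sf [::].
  split; first by have [] := sf [::].
  move=> a; split; first by have [_] := sf [::]; apply.
  exact/IH/smooth_partial.
move=> h s; elim/last_ind: s f h => [|s a IH] f h.
  by have [cf df] := h 1%N; split=> // a p; have [] := df a.
rewrite partial_rcons; apply: IH => n.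
by have [_ /(_ a)[]] := h n.+1.
Qed.

Lemma smooth_Cn n f : smooth f -> Cn n f.
Proof. by move/smoothP. Qed.

Lemma smooth_continuous f : smooth f -> continuous f.
Proof. by case/(_ [::]). Qed.

Lemma smooth_derivable f (a : axis) p : smooth f -> derivable f p (axis_vec R a).
Proof. by case/(_ [::]) => _; exact. Qed.

Lemma smooth_is_derive f (a : axis) p : smooth f ->
  is_derive p (axis_vec R a) f (partial [:: a] f p).
Proof. by move=> sf; apply/derivableP/smooth_derivable. Qed.

Lemma partialE f g (a : axis) :
  (forall p, is_derive p (axis_vec R a) f (g p)) -> partial [:: a] f = g.
Proof. by move=> h; apply/funext => p; have [] := h p. Qed.

Lemma CnD n f g : Cn n f -> Cn n g -> Cn n (fun p => f p + g p).
Proof.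
elim: n f g => [|n IH] f g [cf hf] [cg hg].
  by split=> // p; apply: continuousD; [exact: cf|exact: cg].
split; first by move=> p; apply: continuousD; [exact: cf|exact: cg].
move=> a; have [df Cf] := hf a; have [dg Cg] := hg a.
have h p : is_derive p (axis_vec R a) (fun p => f p + g p)
    (partial [:: a] f p + partial [:: a] g p).
  exact: (is_deriveD (derivableP (df p)) (derivableP (dg p))).
by split=> [p|]; [case: (h p)|rewrite (partialE h); exact: IH].
Qed.

Lemma CnM n f g : Cn n f -> Cn n g -> Cn n (fun p => f p * g p).
Proof.
elim: n f g => [|n IH] f g Hf Hg.
  by split=> // p; apply: continuousM; [case: Hf => + _|case: Hg => + _]; exact.
have Wf := CnW Hf; have Wg := CnW Hg.
case: Hf => cf hf; case: Hg => cg hg.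
split; first by move=> p; apply: continuousM; [exact: cf|exact: cg].
move=> a; have [df Cf] := hf a; have [dg Cg] := hg a.
have h p : is_derive p (axis_vec R a) (fun p => f p * g p)
    (f p * partial [:: a] g p + g p * partial [:: a] f p).
  exact: (is_deriveM (derivableP (df p)) (derivableP (dg p))).
split=> [p|]; first by case: (h p).
by rewrite (partialE h); apply: CnD; exact: IH.
Qed.

Lemma smoothD f g : smooth f -> smooth g -> smooth (fun p => f p + g p).
Proof. by move=> /smoothP hf /smoothP hg; apply/smoothP => n; exact: CnD. Qed.

Lemma smoothM f g : smooth f -> smooth g -> smooth (fun p => f p * g p).
Proof. by move=> /smoothP hf /smoothP hg; apply/smoothP => n; exact: CnM. Qed.

Lemma partialD f g (a : axis) : smooth f -> smooth g ->
  partial [:: a] (fun p => f p + g p) =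
  (fun p => partial [:: a] f p + partial [:: a] g p).
Proof.
move=> sf sg; apply: partialE => p.
exact: (is_deriveD (smooth_is_derive a p sf) (smooth_is_derive a p sg)).
Qed.

Lemma partialM f g (a : axis) : smooth f -> smooth g ->
  partial [:: a] (fun p => f p * g p) =
  (fun p => f p * partial [:: a] g p + g p * partial [:: a] f p).
Proof.
move=> sf sg; apply: partialE => p.
exact: (is_deriveM (smooth_is_derive a p sf) (smooth_is_derive a p sg)).
Qed.

Lemma partial_cst (c : R) (a : axis) :
  partial [:: a] (fun=> c) = (fun=> 0 : R).
Proof. by apply: partialE => p; exact: is_derive_cst. Qed.

Lemma smooth_cst (c : R) : smooth (fun=> c).
Proof.
apply/smoothP => n; elim: n c => [|n IH] c.
  by split=> // p; exact: cst_continuous.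
split; first by move=> p; exact: cst_continuous.
by move=> a; split; [move=> p; exact: derivable_cst|rewrite partial_cst].
Qed.

Lemma partial_fst (a : axis) :
  partial [:: a] (fun p : R * R => p.1) = (fun=> (axis_vec R a).1).
Proof. by apply: partialE => p; exact: is_derive_fst. Qed.

Lemma partial_snd (a : axis) :
  partial [:: a] (fun p : R * R => p.2) = (fun=> (axis_vec R a).2).
Proof. by apply: partialE => p; exact: is_derive_snd. Qed.

Lemma smooth_fst : smooth (fun p : R * R => p.1).
Proof.
apply/smoothP => -[|n]; first by split=> // p; exact: cvg_fst.
split; first by move=> p; exact: cvg_fst.
move=> a; split; last by rewrite partial_fst; apply: smooth_Cn; exact: smooth_cst.
by move=> p; case: (is_derive_fst p (axis_vec R a)).
Qed.

Lemma smooth_snd : smooth (fun p : R * R => p.2).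
Proof.
apply/smoothP => -[|n]; first by split=> // p; exact: cvg_snd.
split; first by move=> p; exact: cvg_snd.
move=> a; split; last by rewrite partial_snd; apply: smooth_Cn; exact: smooth_cst.
by move=> p; case: (is_derive_snd p (axis_vec R a)).
Qed.

Lemma smoothZ (c : R) f : smooth f -> smooth (fun p => c * f p).
Proof. by apply: smoothM; exact: smooth_cst. Qed.

Lemma partialZ (c : R) f (a : axis) : smooth f ->
  partial [:: a] (fun p => c * f p) = (fun p => c * partial [:: a] f p).
Proof.
move=> sf; rewrite partialM//; last exact: smooth_cst.
by apply/funext => p; rewrite partial_cst mulr0 addr0.
Qed.

(** The derivatives of exp(-1/s), extended by 0 to s <= 0, are combinations of
    the functions s^-m exp(-1/s); the whole family is kept because it is closed
    under differentiation, so that smoothness follows by induction. *)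
Definition flat (m : nat) (s : R) : R :=
  if 0 < s then s^-1 ^+ m * expR (- s^-1) else 0.

Lemma flat_ge0 (m : nat) (s : R) : 0 <= flat m s.
Proof.
rewrite /flat; case: ifPn => // s0.
by rewrite mulr_ge0 ?expR_ge0// exprn_ge0// invr_ge0 ltW.
Qed.

(** With t = 1/s, exp(t) >= (t/(m+1))^(m+1): the exponential beats the power
    with one factor s to spare, which gives differentiability at 0. *)
Lemma flat_le (m : nat) (s : R) : 0 < s -> flat m s <= m.+1%:R ^+ m.+1 * s.
Proof.
move=> s0; rewrite /flat s0.
have m0 : 0 < m.+1%:R :> R by rewrite ltr0n.
have si0 : 0 < s^-1 by rewrite invr_gt0.
have h : (s^-1 / m.+1%:R) ^+ m.+1 <= expR (s^-1).
  have -> : expR (s^-1) = (expR (s^-1 / m.+1%:R)) ^+ m.+1.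
    by rewrite -expRM_natl -mulr_natl mulrC divfK// gt_eqF.
  rewrite ler_pXn2r ?nnegrE ?expR_ge0 ?divr_ge0 ?(ltW si0) ?(ltW m0)//.
  by apply: le_trans _ (expR_ge1Dx _); rewrite lerDr.
rewrite expRN -ler_pdivlMr ?invr_gt0 ?expR_gt0// invrK.
have -> : s^-1 ^+ m = m.+1%:R ^+ m.+1 * s * (s^-1 / m.+1%:R) ^+ m.+1.
  have mn0 : m.+1%:R ^+ m.+1 != 0 :> R by rewrite expf_neq0 ?gt_eqF.
  rewrite expr_div_n [s^-1 ^+ m.+1]exprS.
  move: mn0 (lt0r_neq0 s0); move: (_ ^+ m.+1) (_ ^+ m) => A B A0 sn0.
  by field; rewrite A0 sn0.
by apply: ler_wpM2l h; rewrite mulr_ge0 ?exprn_ge0// ltW.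
Qed.

(** For s < 0 the function is constant and for s > 0 this is the product rule; at
    0 the difference quotient from the right is [flat m.+1], which tends to 0 by
    [flat_le]. *)
Lemma is_derive_flat (m : nat) (s : R) :
  is_derive s 1 (flat m) (flat m.+2 s - m%:R * flat m.+1 s).
Proof.
have [s0|s0|->] := ltgtP s 0.
- rewrite /flat ltNge (ltW s0)/= mulr0 subr0.
  apply: (@near_eq_is_derive _ _ _ (cst 0)).
  near=> t; rewrite /= ltNge; suff -> : t <= 0 by [].
  by apply: ltW; near: t; exact: lt_nbhsl.
- have sn0 : s != 0 by rewrite gt_eqF.
  have dV : is_derive s 1 (fun y : R => y^-1) (- s ^- 2 *: 1).
    exact: (@is_deriveV _ id).
  have dN := is_deriveN dV.
  have dE := @is_derive1_comp _ expR (- (fun y : R => y^-1)) s _ _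
    (is_derive_expR _) dN.
  have dM := is_deriveM (is_deriveX m dV) dE.
  have e : \forall t \near s, ((fun y : R => y^-1) ^+ m *
      (expR \o - (fun y : R => y^-1))) t = flat m t.
    near=> t; rewrite /flat; have -> : 0 < t by near: t; exact: lt_nbhsr.
    by rewrite !fctE.
  apply: (near_eq_is_derive e); apply: (is_derive_eq dM).
  rewrite /flat s0 !fctE /GRing.scale/=.
  by case: m {dM e} => [|m] /=; rewrite ?exprS; field.
- rewrite {2 3}/flat ltxx mulr0 subr0.
  suff h : (fun h : R => h^-1 *: ((flat m \o shift 0) (h *: 1) - flat m 0))
      @ 0^' --> 0.
    by apply: DeriveDef; [apply/cvg_ex; exists 0|exact: cvg_lim h].
  apply/cvgrPdist_le => e e0; near=> h.
  rewrite sub0r normrN /= addr0 {2}/flat ltxx subr0 [h *: 1]mulr1.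
  have [h0|h0] := leP h 0; first by rewrite /flat ltNge h0/= scaler0 normr0 ltW.
  rewrite /GRing.scale/= ger0_norm ?mulr_ge0 ?flat_ge0 ?invr_ge0 ?(ltW h0)//.
  have -> : h^-1 * flat m h = flat m.+1 h by rewrite /flat h0 exprS mulrA.
  apply: le_trans (flat_le _ h0) _.
  rewrite -ler_pdivlMl ?exprn_gt0 ?ltr0n//.
  rewrite -(ger0_norm (ltW h0)).
  near: h; apply: dnbhs0_le.
  by rewrite mulr_gt0 ?invr_gt0 ?exprn_gt0 ?ltr0n.
Unshelve. all: by end_near. Qed.

Lemma flat_continuous (m : nat) : continuous (flat m).
Proof.
move=> s; apply: differentiable_continuous; apply/derivable1_diffP.
by case: (is_derive_flat m s).
Qed.

(** The chain rule keeps the derivative in the same family, for other values of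
    [m], times a smooth factor; hence the induction is uniform in [m]. *)
Lemma smooth_flat_comp m f : smooth f -> smooth (flat m \o f).
Proof.
move=> sf; apply/smoothP => n; elim: n m => [|n IH] m.
  by split=> // p; apply: continuous_comp;
    [exact: smooth_continuous|exact: flat_continuous].
split.
  by move=> p; apply: continuous_comp;
    [exact: smooth_continuous|exact: flat_continuous].
move=> a.
have h p := is_derive_comp1 (is_derive_flat m (f p)) (smooth_is_derive a p sf).
split=> [p|]; first by case: (h p).
rewrite (partialE h); apply: CnM; last first.
  by apply: smooth_Cn; exact: smooth_partial.
have -> : (fun p => flat m.+2 (f p) - m%:R * flat m.+1 (f p)) =
  (fun p => (flat m.+2 \o f) p + (- m%:R) * (flat m.+1 \o f) p).
  by apply/funext => p /=; rewrite mulNr.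
apply: CnD => //; apply: CnM => //.
by apply: smooth_Cn; exact: smooth_cst.
Qed.

End SmoothFunctions.

(** * Symmetry of mixed derivatives *)

Section Schwarz.
Context {R : realType}.
Implicit Types (f : R * R -> R) (p v w : R * R).

Lemma is_derive_along f p v (t df : R) : is_derive (t *: v + p) v f df ->
  is_derive t 1 (fun s : R => f (s *: v + p)) df.
Proof.
move=> /is_derive_line h.
have := @is_derive1_comp _ (fun s : R => f (s *: v + (t *: v + p)))
  (fun s => s - t) t df 1.
rewrite subrr mulr1 => /(_ h).
have dt : is_derive t 1 (fun s : R => s - t) 1.
  by apply: is_derive_eq; rewrite oppr0 addr0.
move=> /(_ dt); congr is_derive; apply/funext => s /=.
by rewrite addrA -scalerDl subrK.
Qed.

Lemma MVT_along f p v (h : R) : 0 < h -> (forall q, derivable f q v) ->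
  exists2 t, 0 < t < h & f (h *: v + p) - f p = 'D_v f (t *: v + p) * h.
Proof.
move=> h0 df.
have dg (t : R) : is_derive t 1 (fun s : R => f (s *: v + p)) ('D_v f (t *: v + p)).
  exact/is_derive_along/derivableP.
have cg : {within `[0, h], continuous (fun s : R => f (s *: v + p))}.
  apply: continuous_subspaceT => t; apply: differentiable_continuous.
  by apply/derivable1_diffP; case: (dg t).
have [t th] := MVT h0 (fun t _ => dg t) cg.
rewrite scale0r add0r subr0 => ->; by exists t; move: th; rewrite in_itv.
Qed.

(** Two applications of the mean value theorem turn the double increment over a
    parallelogram into a mixed derivative at one of its points. *)
Lemma second_difference f p v w (h : R) : 0 < h ->
  (forall q, derivable f q v) -> (forall q, derivable ('D_v f) q w) ->
  exists s t, [/\ 0 < s < h, 0 < t < h &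
    f (h *: v + (h *: w + p)) - f (h *: w + p) - f (h *: v + p) + f p =
    'D_w ('D_v f) (t *: w + (s *: v + p)) * h ^+ 2].
Proof.
move=> h0 df ddf.
pose g q := f (h *: w + q) - f q.
have dg q : is_derive q v g ('D_v f (h *: w + q) - 'D_v f q).
  apply: is_deriveB; last exact: derivableP.
  apply/is_derive_line.
  have := derivableP (df (h *: w + q)).
  move/is_derive_line; congr is_derive.
  by apply/funext => t; rewrite addrCA.
have [s sh es] := @MVT_along g p v h h0 (fun q => @ex_derive _ _ _ _ _ _ _ (dg q)).
have [t th et] := @MVT_along ('D_v f) (s *: v + p) w h h0 ddf.
exists s, t; split => //.
have [_ dgE] := dg (s *: v + p).
move: es; rewrite dgE et expr2 mulrA => <-; rewrite /g addrCA.
by ring.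
Qed.

Lemma dist_le_of_common (a b c e : R) :
  `|a - c| < e / 2 -> `|b - c| < e / 2 -> `|a - b| <= e.
Proof.
by rewrite ltr_norml ltr_norml ler_norml => /andP[? ?] /andP[? ?]; lra.
Qed.

(** The double increment is symmetric in [v] and [w], so the two mixed
    derivatives take a common value at points arbitrarily close to [p];
    continuity moves this to [p]. *)
Lemma derive_commute f p v w :
  (forall q, derivable f q v) -> (forall q, derivable f q w) ->
  (forall q, derivable ('D_v f) q w) -> (forall q, derivable ('D_w f) q v) ->
  continuous ('D_w ('D_v f)) -> continuous ('D_v ('D_w f)) ->
  'D_w ('D_v f) p = 'D_v ('D_w f) p.
Proof.
move=> dv dw dvw dwv cA cB.
apply/eqP; rewrite -subr_eq0 -normr_le0; apply/ler_addgt0Pl => e e0.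
rewrite addr0.
have e2 : 0 < e / 2 by rewrite divr_gt0.
have /cvgrPdist_lt/(_ _ e2)/nbhs_ballP[/= d1 d10 hA] := cA p.
have /cvgrPdist_lt/(_ _ e2)/nbhs_ballP[/= d2 d20 hB] := cB p.
pose N := `|v| + `|w| + 1.
have N0 : 0 < N by rewrite ltr_wpDl// addr_ge0.
pose h := Num.min d1 d2 / N.
have h0 : 0 < h by rewrite divr_gt0// lt_min d10.
have hN : h * (`|v| + `|w|) < Num.min d1 d2.
  rewrite -[ltRHS](divfK (lt0r_neq0 N0)) -/h ltr_pM2l// /N; lra.
have near_p x y (s t : R) : 0 < s < h -> 0 < t < h -> `|x| + `|y| = `|v| + `|w| ->
    `|p - (t *: y + (s *: x + p))| < Num.min d1 d2.
  move=> /andP[s0 sh] /andP[t0 th] xy; apply: le_lt_trans hN.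
  rewrite distrC addrA addrK; apply: le_trans (ler_normD _ _) _.
  rewrite !normrZ !gtr0_norm// -xy addrC mulrDr.
  by apply: lerD; apply: ler_wpM2r => //; exact: ltW.
have [s [t [sh th est]]] := second_difference p h0 dv dvw.
have [s' [t' [sh' th' est']]] := second_difference p h0 dw dwv.
have hh : h ^+ 2 != 0 by rewrite sqrf_eq0 gt_eqF.
have E : 'D_w ('D_v f) (t *: w + (s *: v + p)) =
         'D_v ('D_w f) (t' *: v + (s' *: w + p)).
  apply: (mulIf hh); apply: (etrans (esym est)); apply: (etrans _ est').
  by rewrite (addrCA (h *: w) (h *: v) p); congr (_ + _); exact: addrAC.
have bA : `|'D_w ('D_v f) p - 'D_w ('D_v f) (t *: w + (s *: v + p))| < e / 2.
  apply: hA; rewrite -ball_normE/=.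
  apply: (lt_le_trans (near_p v w s t sh th erefl)).
  by rewrite ge_min lexx.
have bB : `|'D_v ('D_w f) p - 'D_v ('D_w f) (t' *: v + (s' *: w + p))| < e / 2.
  apply: hB; rewrite -ball_normE/=.
  apply: (lt_le_trans (near_p w v s' t' sh' th' (addrC _ _))).
  by rewrite ge_min lexx orbT.
by rewrite -E in bB; exact: dist_le_of_common bA bB.
Qed.

Lemma partial_commute f (a b : axis) : smooth f ->
  partial [:: a; b] f = partial [:: b; a] f.
Proof.
move=> sf; apply/funext => p; 
apply: (@derive_commute f p (axis_vec R b) (axis_vec R a)).
- by move=> q; exact: (smooth_derivable sf).
- by move=> q; exact: (smooth_derivable sf).
- by move=> q; exact: (smooth_derivable (smooth_partial b sf)).
- by move=> q; exact: (smooth_derivable (smooth_partial a sf)).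
- by case: (sf [:: a; b]).
- by case: (sf [:: b; a]).
Qed.
End Schwarz.

(** * Measurability and integrability on the plane *)

Section PlaneMeasure.
Context {R : realType}.
Local Notation plane := (measurableTypeR R * measurableTypeR R)%type.
Implicit Types (f : R * R -> R) (p : R * R) (r : R).

(** An open set is the union of the countably many rational rectangles that it
    contains, and rectangles are measurable for the product structure. *)
Lemma open_measurable_plane (U : set (R * R)) :
  open U -> measurable (U : set plane).
Proof.
move=> oU.
pose box (i : rat * rat * (rat * rat)) : set plane :=
  (`]ratr i.1.1, ratr i.1.2[ : set (measurableTypeR R)) `*`
  (`]ratr i.2.1, ratr i.2.2[ : set (measurableTypeR R)).
pose F i := if `[< box i `<=` U >] then box i else set0.
have -> : (U : set plane) = \bigcup_i F i.
  apply/seteqP; split=> [p Up|p [i _]]; last first.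
    by rewrite /F; case: asboolP => // + bp; exact.
  have /nbhs_ballP[e /= e0 eU] := open_nbhs_nbhs (conj oU Up).
  have lo x : x - e < x by rewrite ltrBlDr ltrDl.
  have hi x : x < x + e by rewrite ltrDl.
  have [a] := rat_in_itvoo (lo p.1); have [b] := rat_in_itvoo (hi p.1).
  have [c] := rat_in_itvoo (lo p.2); have [d] := rat_in_itvoo (hi p.2).
  rewrite !in_itv/= => /andP[d1 d2] /andP[c1 c2] /andP[b1 b2] /andP[a1 a2].
  exists (a, b, (c, d)) => //; rewrite /F; case: asboolP => [_|]; last first.
    case; move=> q [/=]; rewrite !in_itv/= => /andP[q1 q2] /andP[q3 q4].
    apply: eU; split; rewrite /ball/= ltr_distlC; apply/andP; split; lra.
  by split; rewrite /= in_itv/=; apply/andP.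
apply: countable_bigcupT_measurable => // i; rewrite /F.
by case: ifP => _; [apply: measurableX; exact: measurable_itv|exact: measurable0].
Qed.

Lemma continuous_measurable_plane f (D : set plane) :
  measurable D -> continuous f -> measurable_fun D (f : plane -> R).
Proof.
move=> mD cf; apply: measurable_funTS.
apply: (measurability _ (RGenOpens.measurableE R)).
move=> _ [_ [a [b ->] <-]]; rewrite setTI; apply: open_measurable_plane.
by move/continuousP : cf; apply; exact: interval_open.
Qed.

Definition sqnorm (p : R * R) : R := p.1 ^+ 2 + p.2 ^+ 2.

Lemma smooth_sqnorm : smooth sqnorm.
Proof.
exact: smoothD (smoothM smooth_fst smooth_fst) (smoothM smooth_snd smooth_snd).
Qed.

Lemma open_disk r : open (disk r).
Proof.
have -> : disk r = sqnorm @^-1` `]-oo, r ^+ 2[.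
  by apply/seteqP; split=> p /=; rewrite in_itv.
by apply: open_comp => [p _|]; [exact: smooth_continuous smooth_sqnorm p|].
Qed.

Lemma measurable_disk r : measurable (disk r : set plane).
Proof. by apply: open_measurable_plane; exact: open_disk. Qed.

Definition square (r : R) : set (R * R) := `[- r, r] `*` `[- r, r].

Lemma compact_square r : compact (square r).
Proof. by apply: compact_setX; exact: segment_compact. Qed.

Lemma sqnorm_square r p : 0 < r -> sqnorm p <= r ^+ 2 -> square r p.
Proof.
rewrite /sqnorm => r0 h.
have := sqr_ge0 p.1; have := sqr_ge0 p.2 => h2 h1.
have bnd x : x ^+ 2 <= r ^+ 2 -> - r <= x <= r.
  by rewrite -ler_norml -(real_normK (num_real x)) ler_pXn2r ?nnegrE// ltW.
by split; rewrite /= in_itv/=; apply: bnd; lra.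
Qed.

Lemma disk_square r : 0 < r -> disk r `<=` square r.
Proof. by move=> r0 p /ltW; exact: sqnorm_square. Qed.

Lemma leb2_square_lty r : (leb2 R (square r) < +oo)%E.
Proof.
have -> : leb2 R (square r) = (@lebesgue_measure R `[(- r)%R, r] *
    @lebesgue_measure R `[(- r)%R, r])%E.
  by apply: product_measure1E; exact: measurable_itv.
rewrite !lebesgue_measure_itv/=.
by case: ifP => _; rewrite ?mule0 ?ltry// -EFinD -EFinM ltry.
Qed.

Lemma measurable_square r : measurable (square r : set plane).
Proof. by apply: measurableX; exact: measurable_itv. Qed.

(** The disk is not compact; its bounding square is, so a continuous function is
    bounded and integrable there. *)
Lemma continuous_square_integrable f r : continuous f ->
  (leb2 R).-integrable (square r) (EFin \o f).
Proof.
move=> cf; apply: measurable_bounded_integrable.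
- exact: measurable_square.
- exact: leb2_square_lty.
- by apply: continuous_measurable_plane => //; exact: measurable_square.
- have := @continuous_compact _ _ f _ (continuous_subspaceT cf) (@compact_square r).
  move/compact_bounded => [M [Mr h]]; exists M; split=> // x Mx p sp.
  by apply: (h x Mx); exists p.
Qed.

Lemma continuous_disk_integrable f r : 0 < r -> continuous f ->
  (leb2 R).-integrable (disk r) (EFin \o f).
Proof.
move=> r0 cf; apply: integrableS (continuous_square_integrable r cf).
- exact: measurable_square.
- exact: measurable_disk.
- exact: disk_square.
Qed.

Lemma continuous_sqint f r : 0 < r -> continuous f ->
  sqint (leb2 R) (disk r) f.
Proof.
move=> r0 cf; apply: sqint_of_integrable.
- exact: measurable_disk.
- by apply: continuous_measurable_plane => //; exact: measurable_disk.
- have := @continuous_disk_integrable (fun p => f p * f p) r r0; apply.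
  by move=> p; apply: continuousM; exact: cf.
Qed.

End PlaneMeasure.

(** * The divergence theorem on a disk *)

Section FundamentalTheorem.
Context {R : realType}.
Local Notation mu := (@lebesgue_measure R).

Lemma primitive_exists (k : R -> R) (a b : R) : continuous k ->
  exists K : R -> R, forall x, a < x < b -> is_derive x 1 K (k x).
Proof.
move=> ck; exists (fun x => \int[mu]_(t in `[a, x]) k t) => x /andP[ax xb].
have ik : mu.-integrable `[a, b] (EFin \o k).
  apply: continuous_compact_integrable; first exact: segment_compact.
  exact: continuous_subspaceT.
have [dK eK] := @continuous_FTC1_closed R k a x b xb ik ax (ck x).
by rewrite -eK derive1E; exact: derivableP.
Qed.

Lemma Rintegral_primitive (K k : R -> R) (s t : R) : s <= t -> continuous k ->
  (forall x, s <= x <= t -> is_derive x 1 K (k x)) ->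
  \int[mu]_(x in `[s, t]) k x = K t - K s.
Proof.
rewrite le_eqVlt => /predU1P[<- _ _|st ck dK].
  by rewrite subrr set_itv1 Rintegral_set1.
have cK x : s <= x <= t -> {for x, continuous K}.
  move=> /dK[h _]; apply: differentiable_continuous.
  exact/derivable1_diffP.
rewrite /Rintegral (@continuous_FTC2 _ k K s t st) ?fineB//.
- exact: continuous_subspaceT.
- split.
  + by move=> x; rewrite in_itv/= => /andP[/ltW sx /ltW xt]; case: (dK x);
      rewrite ?sx ?xt.
  + by apply: cvg_at_right_filter; apply: cK; rewrite lexx ltW.
  + by apply: cvg_at_left_filter; apply: cK; rewrite lexx ltW.
- move=> x; rewrite in_itv/= => /andP[/ltW sx /ltW xt].
  by rewrite derive1E; case: (dK x); rewrite ?sx ?xt.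
Qed.

(** Changes of variable on the circle are checked by differentiating a candidate
    primitive, and this lemma compares the increments. *)
Lemma primitive_unique (A B g : R -> R) (s t : R) : s <= t -> continuous g ->
  (forall x, s <= x <= t -> is_derive x 1 A (g x)) ->
  (forall x, s <= x <= t -> is_derive x 1 B (g x)) ->
  A t - A s = B t - B s.
Proof.
move=> st cg dA dB.
by rewrite -(Rintegral_primitive st cg dA) -(Rintegral_primitive st cg dB).
Qed.

End FundamentalTheorem.

Section DivergenceDisk.
Context {R : realType}.
Local Notation mu := (@lebesgue_measure R).
Local Notation mE := (measurableTypeR R).
Variable r : R.
Hypothesis r0 : 0 < r.

Lemma continuous_slice (F : R * R -> R) (y : R) : continuous F ->
  continuous (fun x : R => F (x, y)).
Proof.
move=> cF x; apply: (@continuous_comp _ _ _ (fun x : R => (x, y)) F); last exact: cF.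
by apply: (@cvg_pair _ _ _ (nbhs x) (nbhs x) (nbhs y));
  [exact: cvg_id|exact: cvg_cst].
Qed.

Lemma continuous_circle : continuous (circle r).
Proof.
move=> t; apply: (@cvg_pair _ _ _ (nbhs t) (nbhs (r * cos t)) (nbhs (r * sin t)));
  apply: cvgMl_tmp;  [exact: continuous_cos|exact: continuous_sin].
Qed.

Lemma disk_slice (x y : R) :
  disk r (x, y) <->
  x \in `]- Num.sqrt (r ^+ 2 - y ^+ 2), Num.sqrt (r ^+ 2 - y ^+ 2)[.
Proof.
rewrite /disk/= in_itv/= -ltr_norml -(sqrtr_sqr x).
have [h|h] := ltP 0 (r ^+ 2 - y ^+ 2).
  by rewrite ltr_sqrt// ltrBrDr.
rewrite (ler0_sqrtr h) [X in _ <-> is_true X]ltNge sqrtr_ge0/=; split => //.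
by have := sqr_ge0 x; lra.
Qed.

Lemma horizontal_lineE (x y : R) : x *: ((1, 0) : R * R) + (0, y) = (x, y).
Proof.
rewrite [LHS]surjective_pairing; congr (_, _).
  by change (x * 1 + 0 = x); rewrite mulr1 addr0.
by change (x * 0 + y = y); rewrite mulr0 add0r.
Qed.

(** Half the length of the horizontal chord at height [y].  A negative number
    has square root 0, so chords outside the disk are empty, uniformly in [y]. *)
Definition half_chord (y : R) : R := Num.sqrt (r ^+ 2 - y ^+ 2).

(** The fundamental theorem of calculus along one chord. *)
Lemma slice_integral (F f : R * R -> R) (y : R) : continuous F -> continuous f ->
  (forall p : R * R, is_derive p (1, 0) F (f p)) ->
  (\int[mu]_x ((f \_ (disk r)) (x, y))%:E =
   (F (half_chord y, y) - F (- half_chord y, y))%:E)%E.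
Proof.
move=> cF cf dF.
have cfy := @continuous_slice f y cf.
have h0 : - half_chord y <= half_chord y.
  by rewrite (@le_trans _ _ 0)// ?oppr_le0 sqrtr_ge0.
have -> : (fun x => ((f \_ (disk r)) (x, y))%:E) =
  (EFin \o (fun x => f (x, y))) \_ `]- half_chord y, half_chord y[.
  apply/funext => x; rewrite !patchE /=.
  have -> : ((x, y) \in disk r) = (x \in [set` `]- half_chord y, half_chord y[]).
    by apply/idP/idP; rewrite !inE /= => /disk_slice.
  by case: ifP.
rewrite -integral_mkcond integral_itv_obnd_cbnd; last first.
  apply/measurable_EFinP/measurable_funTS.
  exact: continuous_measurable_fun.
rewrite integral_itv_bndo_bndc; last first.
  apply/measurable_EFinP/measurable_funTS.
  exact: continuous_measurable_fun.
have ic :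
    mu.-integrable `[- half_chord y, half_chord y] (EFin \o (fun x => f (x, y))).
  apply: continuous_compact_integrable; first exact: segment_compact.
  exact: continuous_subspaceT.
rewrite -[LHS]fineK; last by apply: integrable_fin_num ic; exact: measurable_itv.
congr EFin.
rewrite -[LHS]/(Rintegral _ _ _).
apply: (Rintegral_primitive (K := fun x : R => F (x, y)) h0 cfy) => x _.
have dFx := dF (x, y).
rewrite -(horizontal_lineE x y) in dFx *.
have -> : (fun x : R => F (x, y)) = (fun x => F (x *: (1, 0) + (0, y))).
  by apply/funext => s; rewrite horizontal_lineE.
exact: is_derive_along.
Qed.

Lemma slice_outside (F : R * R -> R) (y : R) : y \notin `[- r, r] ->
  F (half_chord y, y) - F (- half_chord y, y) = 0.
Proof.
move=> yr; rewrite /half_chord ler0_sqrtr ?oppr0 ?subrr// subr_le0.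
have h : r <= `|y|.
  by move: yr; rewrite in_itv/= -ler_norml -ltNge => /ltW.
by rewrite -(real_normK (num_real y)) ler_pXn2r ?nnegrE// ltW.
Qed.

Lemma continuous_chord (F : R * R -> R) : continuous F ->
  continuous (fun y => F (half_chord y, y) - F (- half_chord y, y)).
Proof.
move=> cF.
have ch : continuous (Num.sqrt \o (fun y : R => r ^+ 2 - y ^+ 2)).
  move=> y; apply: continuous_comp;
    last exact: sqrt_continuous.
  by apply: cvgB; [exact: cvg_cst|exact: exprn_continuous].
move=> y; apply: cvgB.
- apply: (@continuous_comp _ _ _ (fun y : R => (half_chord y, y)) F); last exact: cF.
  by apply: (@cvg_pair _ _ _ (nbhs y) (nbhs (half_chord y)) (nbhs y));
    [exact: ch|exact: cvg_id].
- apply: (@continuous_comp _ _ _ (fun y : R => (- half_chord y, y)) F);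
    last exact: cF.
  apply: (@cvg_pair _ _ _ (nbhs y) (nbhs (- half_chord y)) (nbhs y));
    [by apply: cvgN; exact: ch|exact: cvg_id].
Qed.

Lemma is_derive_rsin (t : R) : is_derive t 1 (fun t => r * sin t) (r * cos t).
Proof. exact: (is_deriveZ r (is_derive_sin t)). Qed.

Lemma is_derive_reflect (H : R -> R) (c t dH : R) :
  is_derive (c - t) 1 H dH -> is_derive t 1 (fun t => H (c - t)) (- dH).
Proof.
move=> h; have d : is_derive t 1 (fun t : R => c - t) (- 1).
  by apply: is_derive_eq; rewrite add0r mul1r.
have := @is_derive1_comp _ H (fun t : R => c - t) t _ _ h d.
by rewrite mulrN1.
Qed.

Lemma is_derive_translate (H : R -> R) (c t dH : R) :
  is_derive (t + c) 1 H dH -> is_derive t 1 (fun t => H (t + c)) dH.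
Proof.
move=> h; have d : is_derive t 1 (fun t : R => t + c) 1.
  by apply: is_derive_eq; rewrite addr0.
have := @is_derive1_comp _ H (fun t : R => t + c) t _ _ h d.
by rewrite mulr1.
Qed.

(** The chord at height r sin t joins the boundary points of angles pi - t and t.
    With K a primitive of the left integrand and H one of the right integrand,
    both K(r sin t) and r (H(t) - H(pi - t)) are primitives of the same function
    on [-pi/2, pi/2]; periodicity moves the resulting interval to [0, 2 pi]. *)
Lemma chord_integral (F : R * R -> R) : continuous F ->
  \int[mu]_(y in `[- r, r]) (F (half_chord y, y) - F (- half_chord y, y)) =
  r * \int[mu]_(t in `[0, 2 * pi]) (F (circle r t) * cos t).
Proof.
move=> cF.
pose k y := F (half_chord y, y) - F (- half_chord y, y).
have ck : continuous k by exact: continuous_chord.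
pose h t := F (circle r t) * cos t.
have ch : continuous h.
  move=> t; apply: continuousM; last exact: continuous_cos.
  by apply: continuous_comp; [exact: continuous_circle|exact: cF].
have pi0 := pi_gt0 R; have rp := r0.
have [K dK] := primitive_exists (- r - 1) (r + 1) ck.
have [H dH] := primitive_exists (- (4 * pi)) (4 * pi) ch.
have rr : - r <= r by lra.
have dKr x : - r <= x <= r -> is_derive x 1 K (k x).
  by move=> /andP[x1 x2]; apply: dK; apply/andP; split; lra.
rewrite (Rintegral_primitive rr ck dKr).
have p2 : 0 <= 2 * pi :> R by lra.
have dHp x : 0 <= x <= 2 * pi -> is_derive x 1 H (h x).
  by move=> /andP[x1 x2]; apply: dH; apply/andP; split; lra.
rewrite (Rintegral_primitive p2 ch dHp).
pose g t := k (r * sin t) * (r * cos t).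
have cg : continuous g.
  move=> t; rewrite /g; apply: (cvgM (f := fun t => k (r * sin t))
      (g := fun t => r * cos t)).
    apply: (@continuous_comp _ _ _ (fun t => r * sin t) k); last exact: ck.
    by apply: cvgMl_tmp; exact: continuous_sin.
  by apply: cvgMl_tmp; exact: continuous_cos.
have pp : - (pi / 2) <= pi / 2 :> R by lra.
have dKs t : - (pi / 2) <= t <= pi / 2 ->
    is_derive t 1 (K \o (fun t => r * sin t)) (g t).
  move=> _; have dKt : is_derive (r * sin t) 1 K (k (r * sin t)).
    apply: dK; have := sin_le1 t; have := sin_geN1 t => s1 s2.
    by apply/andP; split; nra.
  exact: (@is_derive1_comp _ K (fun t => r * sin t) t _ _ dKt (is_derive_rsin t)).
have dHs t : - (pi / 2) <= t <= pi / 2 ->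
    is_derive t 1 (fun t => r * (H t - H (pi - t))) (g t).
  move=> /andP[t1 t2].
  (* on this half of the circle cos t >= 0, so half_chord is r cos t *)
  have -> : g t = r * (h t - - h (pi - t)).
    have c0 : 0 <= cos t by apply: cos_ge0_pihalf; rewrite t1.
    have hcE : half_chord (r * sin t) = r * cos t.
      have -> : r * cos t = Num.sqrt ((r * cos t) ^+ 2).
        by rewrite sqrtr_sqr ger0_norm// mulr_ge0// ltW.
      rewrite /half_chord; congr Num.sqrt.
      by rewrite !exprMn sin2cos2; ring.
    rewrite /g /k /h hcE /circle cosB sinB cospi sinpi.
    rewrite !mul0r mulN1r addr0 mulN1r sub0r opprK !mulrN opprK.
    ring.
  apply: is_deriveZ.
  apply: is_deriveB; first by apply: dH; apply/andP; split; lra.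
  by apply: is_derive_reflect; apply: dH; apply/andP; split; lra.
have := primitive_unique pp cg dKs dHs.
rewrite /= sinN sin_pihalf mulrN mulr1 => ->.
have m0 : - (pi / 2) <= 0 :> R by lra.
have per : H 0 - H (- (pi / 2)) = H (2 * pi) - H (- (pi / 2) + 2 * pi).
  have := primitive_unique (A := H) (B := fun t => H (t + 2 * pi)) m0 ch.
  rewrite add0r; apply.
    by move=> x /andP[x1 x2]; apply: dH; apply/andP; split; lra.
  move=> x /andP[x1 x2].
  have -> : h x = h (x + 2 * pi).
    by rewrite /h /circle mulr_natl !cosD2pi ?sinD2pi.
  by apply: is_derive_translate; apply: dH; apply/andP; split; lra.
have -> : pi - pi / 2 = pi / 2 :> R by field.
have -> : pi - - (pi / 2) = - (pi / 2) + 2 * pi :> R by field.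
rewrite -mulrBr; congr (_ * _); lra.
Qed.

Lemma iterated_disk_integral (F f : R * R -> R) : continuous F -> continuous f ->
  (forall p : R * R, is_derive p (1, 0) F (f p)) ->
  (\int[mu]_y \int[mu]_x ((f \_ (disk r)) (x, y))%:E =
   (r * \int[mu]_(t in `[0, (2 * pi)%R]) (F (circle r t) * cos t)%R)%:E)%E.
Proof.
move=> cF cf dF; rewrite -chord_integral//.
under eq_integral do rewrite (slice_integral _ cF cf dF).
have ck := continuous_chord cF.
have ik : mu.-integrable `[- r, r]
    (EFin \o (fun y => F (half_chord y, y) - F (- half_chord y, y))).
  apply: continuous_compact_integrable; first exact: segment_compact.
  exact: continuous_subspaceT.
rewrite /Rintegral fineK; last first.
  by apply: integrable_fin_num ik; exact: measurable_itv.
rewrite [RHS]integral_mkcond; apply: eq_integral => y _.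
rewrite patchE; case: ifPn => //; rewrite notin_setE => /negP h.
by rewrite (@slice_outside F y).
Qed.

Lemma restrict_disk_integrable (f : R * R -> R) : continuous f ->
  (leb2 R).-integrable setT (fun p => ((f \_ (disk r)) p)%:E).
Proof.
move=> cf; have /(integrable_mkcond _ (@measurable_disk R r)) :=
  continuous_disk_integrable r0 cf.
apply: eq_integrable => // p _; rewrite !patchE; by case: ifP.
Qed.

Lemma restrict_disk_integral (f : R * R -> R) :
  (\int[leb2 R]_(p in disk r) (f p)%:E =
   \int[leb2 R]_p ((f \_ (disk r)) p)%:E)%E.
Proof.
rewrite integral_mkcond; apply: eq_integral => p _.
by rewrite !patchE; case: ifP.
Qed.

(** Fubini, integrating first along horizontal chords. *)
Lemma divergence_x (F f : R * R -> R) : continuous F -> continuous f ->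
  (forall p : R * R, is_derive p (1, 0) F (f p)) ->
  \int[leb2 R]_(p in disk r) f p =
  r * \int[mu]_(t in `[0, 2 * pi]) (F (circle r t) * cos t).
Proof.
move=> cF cf dF; rewrite {1}/Rintegral restrict_disk_integral.
rewrite -(integral21_prod_meas1 (restrict_disk_integrable cf)) /fubini_G.
by have -> := iterated_disk_integral cF cf dF.
Qed.

Lemma continuous_swapped (F : R * R -> R) : continuous F ->
  continuous (F \o swap).
Proof.
by move=> cF p; apply: continuous_comp; [exact: swap_continuous|exact: cF].
Qed.

(** The reflection of angles t -> pi/2 - t exchanges the two coordinates on the
    circle; periodicity restores the interval. *)
Lemma rotate_integral (G : R * R -> R) : continuous G ->
  \int[mu]_(t in `[0, 2 * pi]) ((G \o swap) (circle r t) * cos t) =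
  \int[mu]_(t in `[0, 2 * pi]) (G (circle r t) * sin t).
Proof.
move=> cG.
pose h t := G (circle r t) * sin t.
have ch : continuous h.
  move=> t; apply: continuousM; last exact: continuous_sin.
  by apply: continuous_comp; [exact: continuous_circle|exact: cG].
have pi0 := pi_gt0 R.
have [H dH] := primitive_exists (- (4 * pi)) (4 * pi) ch.
have p2 : 0 <= 2 * pi :> R by lra.
pose h' t := (G \o swap) (circle r t) * cos t.
have ch' : continuous h'.
  move=> t; apply: (cvgM (f := (G \o swap) \o circle r)); last first.
    exact: continuous_cos.
  have cGs := continuous_swapped cG.
  exact: (@continuous_comp _ _ _ (circle r) (G \o swap) t
            (@continuous_circle t) (cGs _)).
have dHp x : 0 <= x <= 2 * pi -> is_derive x 1 H (h x).
  by move=> /andP[x1 x2]; apply: dH; apply/andP; split; lra.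
have dHr x : 0 <= x <= 2 * pi -> is_derive x 1 (fun t => - H (pi / 2 - t)) (h' x).
  move=> /andP[x1 x2]; have -> : h' x = - - h (pi / 2 - x).
    rewrite opprK /h' /h /circle /swap/= cosB sinB cos_pihalf sin_pihalf.
    by rewrite !mul0r !mul1r add0r subr0.
  apply: is_deriveN; apply: is_derive_reflect; apply: dH.
  by apply/andP; split; lra.
rewrite (Rintegral_primitive p2 ch dHp) (Rintegral_primitive p2 ch' dHr).
have m0 : pi / 2 - 2 * pi <= 0 :> R by lra.
have : H 0 - H (pi / 2 - 2 * pi) = H (2 * pi) - H (pi / 2 - 2 * pi + 2 * pi).
  have := primitive_unique (A := H) (B := fun t => H (t + 2 * pi)) m0 ch.
  rewrite add0r; apply.
    by move=> x /andP[x1 x2]; apply: dH; apply/andP; split; lra.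
  move=> x /andP[x1 x2].
  have -> : h x = h (x + 2 * pi).
    by rewrite /h /circle mulr_natl !cosD2pi ?sinD2pi.
  by apply: is_derive_translate; apply: dH; apply/andP; split; lra.
rewrite subrK subr0; lra.
Qed.

(** The other order of integration in Fubini, after exchanging the coordinates. *)
Lemma divergence_y (G g : R * R -> R) : continuous G -> continuous g ->
  (forall p : R * R, is_derive p (0, 1) G (g p)) ->
  \int[leb2 R]_(p in disk r) g p =
  r * \int[mu]_(t in `[0, 2 * pi]) (G (circle r t) * sin t).
Proof.
move=> cG cg dG; rewrite -rotate_integral// {1}/Rintegral restrict_disk_integral.
rewrite -(integral12_prod_meas1 (restrict_disk_integrable cg)) /fubini_F.
have dF (p : R * R) : is_derive p (1, 0) (G \o swap) ((g \o swap) p).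
  apply/is_derive_line; have /is_derive_line := dG (swap p).
  by congr is_derive.
have E := iterated_disk_integral (continuous_swapped cG) (continuous_swapped cg) dF.
rewrite -[RHS]/(fine (_%:E)) -{}E.
congr fine; apply: eq_integral => x _; apply: eq_integral => y _.
rewrite !patchE /=; congr (if _ then _ else _)%:E.
by apply/idP/idP; rewrite !inE /disk/= addrC.
Qed.

End DivergenceDisk.

(** * Cutoffs and weakly null functions *)

Section Cutoff.
Context {R : realType}.
Variable r : R.
Hypothesis r0 : 0 < r.
Implicit Types (f g z : R * R -> R) (p : R * R).

(** Positive exactly where (n+1) (r^2 - |p|^2) > r^2: the support stays strictly
    inside the disk, and the argument of [flat 0] grows to infinity with [n] at
    each point of the disk, so that the cutoff tends to 1 there. *)
Definition cutoff (n : nat) (p : R * R) : R :=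
  flat 0 (n.+1%:R * (r ^+ 2 - sqnorm p) - r ^+ 2).

Lemma smooth_cutoff n : smooth (cutoff n).
Proof.
apply: (@smooth_flat_comp _ 0 (fun p => n.+1%:R * (r ^+ 2 - sqnorm p) - r ^+ 2)).
have -> : (fun p => n.+1%:R * (r ^+ 2 - sqnorm p) - r ^+ 2) =
    (fun p => n.+1%:R * (r ^+ 2 + -1 * sqnorm p) + - r ^+ 2).
  by apply/funext => p; rewrite mulN1r.
apply: smoothD; last exact: smooth_cst.
apply: smoothZ; apply: smoothD; first exact: smooth_cst.
by apply: smoothZ; exact: smooth_sqnorm.
Qed.

Lemma cutoff_bounds n p : 0 <= cutoff n p <= 1.
Proof.
rewrite /cutoff flat_ge0/= /flat; case: ifPn => // s0.
by rewrite expr0 mul1r -[leRHS]expR0 ler_expR oppr_le0 invr_ge0 ltW.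
Qed.

Lemma cutoff_support n p : cutoff n p != 0 ->
  sqnorm p <= r ^+ 2 - r ^+ 2 / n.+1%:R.
Proof.
rewrite /cutoff /flat; case: ifPn; last by rewrite eqxx.
have n0 : 0 < n.+1%:R :> R by rewrite ltr0n.
move=> h _; rewrite lerBrDr -lerBrDl ler_pdivrMr//.
by rewrite [leRHS]mulrC -subr_ge0 ltW.
Qed.

Lemma cutoff_cvg p : disk r p -> cutoff n p @[n --> \oo] --> (1 : R).
Proof.
move=> dp; have c0 : 0 < r ^+ 2 - sqnorm p by rewrite subr_gt0.
pose s (n : nat) := n.+1%:R * (r ^+ 2 - sqnorm p) - r ^+ 2.
have sy : s n @[n --> \oo] --> +oo.
  apply/cvgryPge => A; near=> n.
  rewrite /s lerBrDr -ler_pdivrMr// (@le_trans _ _ n%:R)// ?ler_nat//.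
  by near: n; exact: nbhs_infty_ger.
have spos : \forall n \near \oo, 0 < s n.
  by move/cvgryPgt : sy; exact.
have si : (s n)^-1 @[n --> \oo] --> (0 : R) by apply/gtr0_cvgV0.
have h : expR (- (s n)^-1) @[n --> \oo] --> (1 : R).
  rewrite -expR0 -oppr0; apply: (@cvg_comp _ _ _ (fun n => - (s n)^-1) expR).
    by apply: cvgN; exact: si.
  exact: continuous_expR.
apply: cvg_trans h; apply: near_eq_cvg; near=> n.
have sn : 0 < s n by near: n.
by rewrite /cutoff -/(s n) /flat sn expr0 mul1r.
Unshelve. all: by end_near. Qed.

(** The bound of [cutoff_support] defines a closed set, so it also contains the
    closure of the support. *)
Lemma test_function_cutoff n z : smooth z ->
  test_function (disk r) (fun p => z p * cutoff n p).
Proof.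
move=> sz; set f := fun p => _.
pose rho := r ^+ 2 - r ^+ 2 / n.+1%:R.
have n0 : 0 < n.+1%:R :> R by rewrite ltr0n.
have rho_lt : rho < r ^+ 2 by rewrite ltrBlDr ltrDl divr_gt0// exprn_gt0.
have cB : closed [set p : R * R | sqnorm p <= rho].
  apply: (@preimage_closed _ _ (@sqnorm R) [set x | x <= rho]); last exact: closed_le.
  by move=> p _; exact: (smooth_continuous smooth_sqnorm).
have sub : closure [set p | f p != 0] `<=` [set p : R * R | sqnorm p <= rho].
  rewrite ((closure_id _).1 cB); apply: closureS => p /=.
  by rewrite mulf_eq0 negb_or => /andP[_]; exact: cutoff_support.
split.
- by apply: smoothM => //; exact: smooth_cutoff.
- apply: (subclosed_compact _ (@compact_square R r)); first exact: closed_closure.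
  move=> p /sub/= h; apply: sqnorm_square => //.
  by apply: le_trans h _; exact: ltW.
- by move=> p /sub/= h; apply: le_lt_trans h _.
Qed.

(** [z] is not a test function, but [z] times a cutoff is; dominated convergence
    removes the cutoff. *)
Lemma weakly_null_smooth (E : R * R -> R) z :
  sqint (leb2 R) (disk r) E ->
  (forall phi, test_function (disk r) phi ->
     \int[leb2 R]_(p in disk r) (E p * phi p) = 0) ->
  smooth z -> ip (leb2 R) (disk r) E z = 0.
Proof.
move=> sE hE sz; have mD := @measurable_disk R r.
have cz : continuous z by exact: smooth_continuous.
have ii f : continuous f ->
    (leb2 R).-integrable (disk r) (EFin \o (fun p => E p * f p)).
  by move=> cf; apply: sqint_mul_integrable => //; exact: continuous_sqint.
have cz_n n : continuous (fun p => z p * cutoff n p).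
  by case: (test_function_cutoff n sz) => /smooth_continuous.
have hn n : (\int[leb2 R]_(p in disk r) (E p * (z p * cutoff n p))%:E = 0)%E.
  rewrite -[LHS]fineK; last exact: integrable_fin_num (ii _ (cz_n n)).
  by congr EFin; exact: hE (test_function_cutoff n sz).
have h : (\int[leb2 R]_(p in disk r) (E p * (z p * cutoff n p))%:E)%E
    @[n --> \oo] --> (\int[leb2 R]_(p in disk r) (E p * z p)%:E)%E.
  apply: (@dominated_cvg _ _ _ (leb2 R) _ mD _ _ (fun p => `|E p * z p|%:E)).
  - by move=> n; exact: measurable_int (ii _ (cz_n n)).
  - move=> p dp; apply: cvg_EFin; first by near=> n.
    rewrite /comp/= -[X in _ --> X]mulr1 -mulrA; apply: cvgMl_tmp.
    by apply: cvgMl_tmp; exact: cutoff_cvg.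
  - by [].
  - exact: integrable_abse (ii _ cz).
  - move=> n p _; rewrite abse_EFin lee_fin mulrA normrM ler_piMr//.
    by have /andP[c0 c1] := cutoff_bounds n p; rewrite ger0_norm.
suff e : (\int[leb2 R]_(p in disk r) (E p * z p)%:E = 0)%E.
  by rewrite /ip /Rintegral e.
have h0 : (fun n : nat =>
    (\int[leb2 R]_(p in disk r) (E p * (z p * cutoff n p))%:E)%E) =
    (fun=> 0%E) by apply/funext => n; exact: hn.
rewrite h0 in h.
exact: (cvg_unique _ h (@cvg_cst _ _ _ _ _)).
Unshelve. all: by end_near. Qed.

(** Testing against smooth functions that converge to [E] itself.  This replaces
    the fundamental lemma of the calculus of variations for those functions
    that are L^2 limits of smooth ones. *)
Lemma weakly_null_null (E : R * R -> R) (z : nat -> R * R -> R) :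
  sqint (leb2 R) (disk r) E ->
  (forall phi, test_function (disk r) phi ->
     \int[leb2 R]_(p in disk r) (E p * phi p) = 0) ->
  (forall n, smooth (z n)) -> sqcvg (leb2 R) (disk r) z E ->
  ip (leb2 R) (disk r) E E = 0.
Proof.
move=> sE hE sz zE; have mD := @measurable_disk R r.
have sqz n : sqint (leb2 R) (disk r) (z n).
  by apply: continuous_sqint => //; exact: smooth_continuous.
have cE : sqcvg (leb2 R) (disk r) (fun _ : nat => E) E.
  rewrite /sqcvg; apply: eq_cvg_fun (@cvg_cst _ 0 _ _ _) => n.
  apply/esym; rewrite /ip.
  under eq_Rintegral do rewrite subrr mulr0.
  by rewrite Rintegral_cst// mul0r.
have h := ip_cvg mD (fun=> sE) sqz sE sE cE zE.
have h0 : (fun n : nat => ip (leb2 R) (disk r) E (z n)) = (fun=> 0).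
  by apply/funext => n; exact: weakly_null_smooth.
rewrite h0 in h.
exact: (cvg_unique _ h (@cvg_cst _ _ _ _ _)).
Qed.

End Cutoff.

(** * Green's identity and the trace inequality for smooth functions *)

Section SmoothIdentities.
Context {R : realType}.
Local Notation mu := (@lebesgue_measure R).
Variable r : R.
Hypothesis r0 : 0 < r.
Implicit Types (f g w a b : R * R -> R) (p : R * R).

Local Notation dip := (ip (leb2 R) (disk r)).

(** The inner product on the circle with respect to the angle; arc length
    contributes the factor [r], which stays outside. *)
Definition cip f g : R :=
  ip mu `[0, 2 * pi] (f \o circle r) (g \o circle r).

Definition normal_part a b p : R := a p * (p.1 / r) + b p * (p.2 / r).

Lemma normal_part_circle a b t :
  normal_part a b (circle r t) = a (circle r t) * cos t + b (circle r t) * sin t.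
Proof.
rewrite /normal_part /circle/= (mulrAC r (cos t)) (mulrAC r (sin t)).
by rewrite divff ?mul1r ?gt_eqF.
Qed.

Lemma continuous_circle_integrable f : continuous f ->
  mu.-integrable `[0, 2 * pi] (EFin \o (f \o circle r)).
Proof.
move=> cf; apply: continuous_compact_integrable; first exact: segment_compact.
apply: continuous_subspaceT => t.
by apply: continuous_comp; [exact: continuous_circle|exact: cf].
Qed.

Lemma continuous_circle_sqint f : continuous f ->
  sqint mu `[0, 2 * pi] (f \o circle r).
Proof.
move=> cf; apply: sqint_of_integrable; first exact: measurable_itv.
  apply: measurable_funTS; apply: continuous_measurable_fun => t.
  by apply: continuous_comp; [exact: continuous_circle|exact: cf].
apply: (@continuous_circle_integrable (fun p => f p * f p)) => p.
by apply: continuousM; exact: cf.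
Qed.

Lemma Rintegral_diskD f g : continuous f -> continuous g ->
  \int[leb2 R]_(p in disk r) (f p + g p) =
  \int[leb2 R]_(p in disk r) f p + \int[leb2 R]_(p in disk r) g p.
Proof.
move=> cf cg; apply: RintegralD; first exact: measurable_disk.
  exact: continuous_disk_integrable.
exact: continuous_disk_integrable.
Qed.

Lemma dip_partialM f g (s : axis) : smooth f -> smooth g ->
  \int[leb2 R]_(p in disk r) partial [:: s] (fun q => f q * g q) p =
  dip f (partial [:: s] g) + dip (partial [:: s] f) g.
Proof.
move=> sf sg; have spf := smooth_partial s sf; have spg := smooth_partial s sg.
have c1 := smooth_continuous (smoothM sf spg).
have c2 := smooth_continuous (smoothM spf sg).
apply: etrans (Rintegral_diskD c1 c2); apply: eq_Rintegral => p _.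
by rewrite partialM// (mulrC (partial _ f p)).
Qed.

(** The divergence theorem for the field w (a, b). *)
Lemma green_smooth w a b : smooth w -> smooth a -> smooth b ->
  (dip w (partial [:: ax_x] a) + dip (partial [:: ax_x] w) a) +
  (dip w (partial [:: ax_y] b) + dip (partial [:: ax_y] w) b) =
  r * cip w (normal_part a b).
Proof.
move=> sw sa sb.
have D1 := dip_partialM ax_x sw sa; have D2 := dip_partialM ax_y sw sb.
apply: (etrans (congr2 +%R (esym D1) (esym D2))) => {D1 D2}.
have swa := smoothM sw sa; have swb := smoothM sw sb.
have cont f : smooth f -> continuous f by exact: smooth_continuous.
have E1 : \int[leb2 R]_(p in disk r) partial [:: ax_x] (fun p => w p * a p) p =
    r * \int[mu]_(t in `[0, 2 * pi]) (w (circle r t) * a (circle r t) * cos t).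
  apply: (@divergence_x _ _ r0 (fun p => w p * a p)).
  - exact: cont.
  - by apply: cont; exact: smooth_partial.
  - by move=> p; exact: (smooth_is_derive ax_x p swa).
have E2 : \int[leb2 R]_(p in disk r) partial [:: ax_y] (fun p => w p * b p) p =
    r * \int[mu]_(t in `[0, 2 * pi]) (w (circle r t) * b (circle r t) * sin t).
  apply: (@divergence_y _ _ r0 (fun p => w p * b p)).
  - exact: cont.
  - by apply: cont; exact: smooth_partial.
  - by move=> p; exact: (smooth_is_derive ax_y p swb).
rewrite E1 E2 -mulrDr; congr (_ * _).
have cwa : continuous (fun t => w (circle r t) * a (circle r t)).
  move=> t; apply: (@continuous_comp _ _ _ (circle r) (fun p => w p * a p)).
    exact: continuous_circle.
  exact: cont.
have cwb : continuous (fun t => w (circle r t) * b (circle r t)).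
  move=> t; apply: (@continuous_comp _ _ _ (circle r) (fun p => w p * b p)).
    exact: continuous_circle.
  exact: cont.
have int_itv (h : R -> R) : continuous h ->
    mu.-integrable `[0, 2 * pi] (EFin \o h).
  move=> ch; apply: continuous_compact_integrable; first exact: segment_compact.
  exact: continuous_subspaceT.
rewrite -RintegralD; first last.
- apply: int_itv => t; apply: cvgM; [exact: cwb|exact: continuous_sin].
- apply: int_itv => t; apply: cvgM; [exact: cwa|exact: continuous_cos].
- exact: measurable_itv.
apply: eq_Rintegral => t _; rewrite /= normal_part_circle.
by rewrite mulrDr !mulrA.
Qed.

(** The left side is the divergence of F^2 (x, y) when (A, B) is the gradient of
    F.  It equals 2 F^2 + 2 F (x A + y B), and Cauchy-Schwarz in the plane bounds
    |x A + y B| by r |(A, B)| on the disk. *)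
Lemma trace_pointwise (F A B x y : R) : 0 < r -> x ^+ 2 + y ^+ 2 < r ^+ 2 ->
  F * (x * A + F) + A * (x * F) + (F * (y * B + F) + B * (y * F)) <=
  (2 + r) * (F * F) + r * (A * A + B * B).
Proof.
move=> rp xy.
have h : r * (2 * F * (x * A + y * B)) <= r * (r * F ^+ 2 + r * (A ^+ 2 + B ^+ 2)).
  have h1 := sqr_ge0 (r * F - (x * A + y * B)).
  have h2 := sqr_ge0 (x * B - y * A).
  have h3 : (x ^+ 2 + y ^+ 2) * (A ^+ 2 + B ^+ 2) <= r ^+ 2 * (A ^+ 2 + B ^+ 2).
    by apply: ler_wpM2r (ltW xy); rewrite addr_ge0 ?sqr_ge0.
  by move: h1 h2 h3; clear; nra.
rewrite (ler_pM2l rp) in h.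
have -> : F * (x * A + F) + A * (x * F) + (F * (y * B + F) + B * (y * F)) =
  2 * F ^+ 2 + 2 * F * (x * A + y * B) by ring.
by move: h; clear; nra.
Qed.

(** Green's identity with the field f (x, y), whose normal component on the
    circle is r f, followed by [trace_pointwise]. *)
Lemma trace_smooth f : smooth f ->
  r * cip f f <= (1 + 2 / r) *
  (dip f f + dip (partial [:: ax_x] f) (partial [:: ax_x] f) +
   dip (partial [:: ax_y] f) (partial [:: ax_y] f)).
Proof.
move=> sf.
have sx := @smooth_fst R; have sy := @smooth_snd R.
have sa := smoothM sx sf; have sb := smoothM sy sf.
have sfx := smooth_partial ax_x sf; have sfy := smooth_partial ax_y sf.
set fx := partial [:: ax_x] f in sfx *; set fy := partial [:: ax_y] f in sfy *.
have := green_smooth sf sa sb.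
have -> : cip f (normal_part (fun p => p.1 * f p) (fun p => p.2 * f p)) =
    r * cip f f.
  rewrite /cip [RHS]mulrC ipC -[RHS]mulrC -ipZl; first last.
  - exact: continuous_circle_sqint (smooth_continuous sf).
  - exact: continuous_circle_sqint (smooth_continuous sf).
  - exact: measurable_itv.
  apply: eq_ip => t _; rewrite /= normal_part_circle /circle/=.
  rewrite [RHS](_ : _ = r * f (r * cos t, r * sin t) * (cos t ^+ 2 + sin t ^+ 2)).
    by ring.
  by rewrite cos2Dsin2 mulr1.
have sax := smooth_partial ax_x sa; have sby := smooth_partial ax_y sb.
set ax := partial [:: ax_x] (fun p => p.1 * f p) in sax *.
set bwy := partial [:: ax_y] (fun p => p.2 * f p) in sby *.
have axE : ax = (fun p => p.1 * fx p + f p * 1).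
  by rewrite /ax (partialM ax_x sx sf) (partial_fst ax_x).
have byE : bwy = (fun p => p.2 * fy p + f p * 1).
  by rewrite /bwy (partialM ax_y sy sf) (partial_snd ax_y).
rewrite -/fx -/fy => G.
have c1 := smooth_continuous (smoothM sf sax).
have c2 := smooth_continuous (smoothM sfx sa).
have c3 := smooth_continuous (smoothM sf sby).
have c4 := smooth_continuous (smoothM sfy sb).
have c12 := smooth_continuous (smoothD (smoothM sf sax) (smoothM sfx sa)).
have c34 := smooth_continuous (smoothD (smoothM sf sby) (smoothM sfy sb)).
have e12 := Rintegral_diskD c1 c2; have e34 := Rintegral_diskD c3 c4.
have eL := Rintegral_diskD c12 c34.
have sff := smoothZ (2 + r) (smoothM sf sf).
have sxx := smoothM sfx sfx; have syy := smoothM sfy sfy.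
have sM := smoothZ r (smoothD sxx syy).
have eM := Rintegral_diskD (smooth_continuous sff) (smooth_continuous sM).
have eS := Rintegral_diskD (smooth_continuous sxx) (smooth_continuous syy).
have intg h : smooth h -> (leb2 R).-integrable (disk r) (EFin \o h).
  by move=> sh; apply: continuous_disk_integrable => //; exact: smooth_continuous.
have mD := @measurable_disk R r.
have zN := RintegralZl (2 + r) mD (intg _ (smoothM sf sf)).
have zM := RintegralZl r mD (intg _ (smoothD sxx syy)).
have le : \int[leb2 R]_(p in disk r) ((f p * ax p + fx p * (p.1 * f p)) +
      (f p * bwy p + fy p * (p.2 * f p))) <=
    \int[leb2 R]_(p in disk r) ((2 + r) * (f p * f p) +
      r * (fx p * fx p + fy p * fy p)).
  apply: le_Rintegral => //.
  - apply: intg; exact: smoothD (smoothD (smoothM sf sax) (smoothM sfx sa))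
      (smoothD (smoothM sf sby) (smoothM sfy sb)).
  - by apply: intg; exact: smoothD.
  move=> p dp; rewrite axE byE !mulr1.
  move: dp; rewrite /disk/=; move: (f p) (fx p) (fy p) p.1 p.2 r0.
  move=> F A B x y rp dp.
  exact: trace_pointwise.
move: G le; rewrite eL e12 e34 eM zN zM eS => ->.
rewrite -/(dip f f) -/(dip fx fx) -/(dip fy fy).
have N0 : 0 <= dip f f by exact: ip_ge0.
have X0 : 0 <= dip fx fx by exact: ip_ge0.
have Y0 : 0 <= dip fy fy by exact: ip_ge0.
move: (dip f f) (dip fx fx) (dip fy fy) N0 X0 Y0 => N X Y N0 X0 Y0 le.
have rp := r0.
rewrite -(ler_pM2l rp); apply: le_trans le _.
rewrite -subr_ge0.
have -> : r * ((1 + 2 / r) * (N + X + Y)) - ((2 + r) * N + r * (X + Y)) =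
    2 * (X + Y) by field; rewrite gt_eqF.
by rewrite mulr_ge0// addr_ge0.
Qed.

End SmoothIdentities.

(** * Limits of smooth functions with a trace *)

Section TracedFunctions.
Context {R : realType}.
Local Notation mu := (@lebesgue_measure R).
Variable r : R.
Hypothesis r0 : 0 < r.
Implicit Types (f g w wx wy gw a b ga gb a_x a_y b_x b_y : R * R -> R) (p : R * R).

Local Notation dip := (ip (leb2 R) (disk r)).
Local Notation dsqint := (sqint (leb2 R) (disk r)).
Local Notation dsqcvg := (sqcvg (leb2 R) (disk r)).
Local Notation cip := (cip r).
Local Notation csqint g := (sqint mu `[0, 2 * pi] (g \o circle r)).
Local Notation csqcvg a g :=
  (sqcvg mu `[0, 2 * pi] (fun n => a n \o circle r) (g \o circle r)).

Let mD : measurable (disk r : set (measurableTypeR R * measurableTypeR R)).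
Proof. exact: measurable_disk. Qed.

Let mC : measurable (`[0, 2 * pi]%classic : set (measurableTypeR R)).
Proof. exact: measurable_itv. Qed.

Definition h1_approx w wx wy g (phi : nat -> R * R -> R) : Prop :=
  [/\ forall n, smooth (phi n), dsqcvg phi w,
      dsqcvg (fun n => partial [:: ax_x] (phi n)) wx,
      dsqcvg (fun n => partial [:: ax_y] (phi n)) wy & csqcvg phi g].

(** The components of the gradient are arguments, since they are sometimes the
    chosen weak derivatives of [w] and sometimes combinations of other functions. *)
Definition h1_trace w wx wy g : Prop :=
  [/\ dsqint w, dsqint wx, dsqint wy, csqint g &
      exists phi, h1_approx w wx wy g phi].

Lemma smooth_dsqint f : smooth f -> dsqint f.
Proof. by move=> sf; apply: continuous_sqint => //; exact: smooth_continuous. Qed.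

Lemma smooth_csqint f : smooth f -> csqint f.
Proof.
by move=> sf; apply: continuous_circle_sqint => //; exact: smooth_continuous.
Qed.

Lemma h1_traceD w wx wy g w' wx' wy' g' :
  h1_trace w wx wy g -> h1_trace w' wx' wy' g' ->
  h1_trace (fun p => w p + w' p) (fun p => wx p + wx' p)
           (fun p => wy p + wy' p) (fun p => g p + g' p).
Proof.
move=> [sw swx swy sg [phi [ss c cx cy cg]]].
move=> [sw' swx' swy' sg' [phi' [ss' c' cx' cy' cg']]].
have sp (s : axis) n : smooth (partial [:: s] (phi n)) by exact: smooth_partial.
have sp' (s : axis) n : smooth (partial [:: s] (phi' n)) by exact: smooth_partial.
have ep (s : axis) : (fun n => partial [:: s] (fun p => phi n p + phi' n p)) =
    (fun n p => partial [:: s] (phi n) p + partial [:: s] (phi' n) p).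
  by apply/funext => n; exact: (partialD s (ss n) (ss' n)).
split; [exact: sqintD|exact: sqintD|exact: sqintD|exact: (sqintD mC sg sg')|].
exists (fun n p => phi n p + phi' n p); split.
- by move=> n; exact: smoothD.
- by apply: (sqcvgD mD _ _ sw sw' c c') => n; exact: smooth_dsqint.
- by rewrite ep; apply: (sqcvgD mD _ _ swx swx' cx cx') => n; exact: smooth_dsqint.
- by rewrite ep; apply: (sqcvgD mD _ _ swy swy' cy cy') => n; exact: smooth_dsqint.
- by apply: (sqcvgD mC _ _ sg sg' cg cg') => n; exact: smooth_csqint.
Qed.

Lemma h1_traceZ k w wx wy g : h1_trace w wx wy g ->
  h1_trace (fun p => k * w p) (fun p => k * wx p)
           (fun p => k * wy p) (fun p => k * g p).
Proof.
move=> [sw swx swy sg [phi [ss c cx cy cg]]].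
have sp (s : axis) n : smooth (partial [:: s] (phi n)) by exact: smooth_partial.
have ep (s : axis) : (fun n => partial [:: s] (fun p => k * phi n p)) =
    (fun n p => k * partial [:: s] (phi n) p).
  by apply/funext => n; exact: (partialZ k s (ss n)).
split; [exact: sqintZ|exact: sqintZ|exact: sqintZ|exact: (sqintZ mC k sg)|].
exists (fun n p => k * phi n p); split.
- by move=> n; exact: smoothZ.
- by apply: (sqcvgZ mD k _ sw c) => n; exact: smooth_dsqint.
- by rewrite ep; apply: (sqcvgZ mD k _ swx cx) => n; exact: smooth_dsqint.
- by rewrite ep; apply: (sqcvgZ mD k _ swy cy) => n; exact: smooth_dsqint.
- by apply: (sqcvgZ mC k _ sg cg) => n; exact: smooth_csqint.
Qed.

Lemma normal_part_comp a b : normal_part r a b \o circle r =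
  (fun t => (a \o circle r) t * cos t + (b \o circle r) t * sin t).
Proof. by apply/funext => t; exact: normal_part_circle. Qed.

Let mcos : measurable_fun (`[0, 2 * pi]%classic : set (measurableTypeR R)) (@cos R).
Proof.
by apply: measurable_funTS; apply: continuous_measurable_fun; exact: continuous_cos.
Qed.

Let msin : measurable_fun (`[0, 2 * pi]%classic : set (measurableTypeR R)) (@sin R).
Proof.
by apply: measurable_funTS; apply: continuous_measurable_fun; exact: continuous_sin.
Qed.

Let cos1 (t : R) : `|cos t| <= 1.
Proof. by rewrite ler_norml cos_geN1 cos_le1. Qed.

Let sin1 (t : R) : `|sin t| <= 1.
Proof. by rewrite ler_norml sin_geN1 sin_le1. Qed.

Lemma csqint_normal_part a b : csqint a -> csqint b ->
  csqint (normal_part r a b).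
Proof.
move=> sa sb; rewrite normal_part_comp.
exact: (sqintD mC (sqint_mul mC mcos cos1 sa) (sqint_mul mC msin sin1 sb)).
Qed.

Lemma csqcvg_normal_part (a b : nat -> R * R -> R) f g :
  (forall n, csqint (a n)) -> (forall n, csqint (b n)) -> csqint f -> csqint g ->
  csqcvg a f -> csqcvg b g ->
  csqcvg (fun n => normal_part r (a n) (b n)) (normal_part r f g).
Proof.
move=> sa sb sf sg af bg.
have -> : (fun n => normal_part r (a n) (b n) \o circle r) =
    (fun n t => (a n \o circle r) t * cos t + (b n \o circle r) t * sin t).
  by apply/funext => n; exact: normal_part_comp.
rewrite normal_part_comp.
have := sqcvgD mC (fun n => sqint_mul mC mcos cos1 (sa n))
  (fun n => sqint_mul mC msin sin1 (sb n))
  (sqint_mul mC mcos cos1 sf) (sqint_mul mC msin sin1 sg).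
by apply; [exact: (sqcvg_mul mC mcos cos1 sa sf af)
          |exact: (sqcvg_mul mC msin sin1 sb sg bg)].
Qed.

(** Both sides of Green's identity are bilinear and continuous for the
    convergences in [h1_approx]. *)
Lemma green_traced w wx wy gw a a_x a_y ga b b_x b_y gb :
  h1_trace w wx wy gw -> h1_trace a a_x a_y ga -> h1_trace b b_x b_y gb ->
  (dip w a_x + dip wx a) + (dip w b_y + dip wy b) =
  r * cip gw (normal_part r ga gb).
Proof.
move=> [sw swx swy sgw [phi [ss c cx cy cg]]].
move=> [sa sax say sga [al [sal ca cax cay cga]]].
move=> [sb sbx sby sgb [be [sbe cb cbx cby cgb]]].
have D f : smooth f -> dsqint f by exact: smooth_dsqint.
have DP s f : smooth f -> dsqint (partial [:: s] f).
  by move=> sf; apply: D; exact: smooth_partial.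
have C f : smooth f -> csqint f by exact: smooth_csqint.
have h1 := ip_cvg mD (fun n => D _ (ss n)) (fun n => DP ax_x _ (sal n)) sw sax c cax.
have h2 := ip_cvg mD (fun n => DP ax_x _ (ss n)) (fun n => D _ (sal n)) swx sa cx ca.
have h3 := ip_cvg mD (fun n => D _ (ss n)) (fun n => DP ax_y _ (sbe n)) sw sby c cby.
have h4 := ip_cvg mD (fun n => DP ax_y _ (ss n)) (fun n => D _ (sbe n)) swy sb cy cb.
have h5 := ip_cvg mC (fun n => C _ (ss n))
  (fun n => csqint_normal_part (C _ (sal n)) (C _ (sbe n))) sgw
  (csqint_normal_part sga sgb) cg
  (csqcvg_normal_part (fun n => C _ (sal n)) (fun n => C _ (sbe n)) sga sgb cga cgb).
have L := cvg_add (cvg_add h1 h2) (cvg_add h3 h4).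
have Rr := @cvg_scale _ r _ _ h5.
have e n := esym (green_smooth r0 (ss n) (sal n) (sbe n)).
exact: (cvg_unique _ L (eq_cvg_fun e Rr)).
Qed.

Lemma trace_traced w wx wy g : h1_trace w wx wy g ->
  r * cip g g <= (1 + 2 / r) * (dip w w + dip wx wx + dip wy wy).
Proof.
move=> [sw swx swy sg [phi [ss c cx cy cg]]].
have D f : smooth f -> dsqint f by exact: smooth_dsqint.
have DP s f : smooth f -> dsqint (partial [:: s] f).
  by move=> sf; apply: D; exact: smooth_partial.
have C f : smooth f -> csqint f by exact: smooth_csqint.
have h0 := ip_cvg mD (fun n => D _ (ss n)) (fun n => D _ (ss n)) sw sw c c.
have hx := ip_cvg mD (fun n => DP ax_x _ (ss n)) (fun n => DP ax_x _ (ss n))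
  swx swx cx cx.
have hy := ip_cvg mD (fun n => DP ax_y _ (ss n)) (fun n => DP ax_y _ (ss n))
  swy swy cy cy.
have half_chord := ip_cvg mC (fun n => C _ (ss n)) (fun n => C _ (ss n)) sg sg cg cg.
have L := @cvg_scale _ r _ _ half_chord.
have Rr := @cvg_scale _ (1 + 2 / r) _ _ (cvg_add (cvg_add h0 hx) hy).
apply: (ler_cvg_to L Rr); near=> n; exact: (trace_smooth r0 (ss n)).
Unshelve. all: by end_near. Qed.

Lemma L2sqE f : dsqint f -> L2sq (disk r) f = (dip f f)%:E.
Proof. exact: sqintE. Qed.

Lemma bL2sqE g : csqint g -> bL2sq r g = (r * cip g g)%:E.
Proof. by move=> sg; rewrite EFinM -(sqintE mC sg). Qed.

(** The factor [r] of arc length is positive, so it does not affect finiteness. *)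
Lemma inbL2_csqint g : inbL2 r g -> csqint g.
Proof.
move=> [mg fg]; split => //; move: fg; rewrite /bL2sq => fg.
have i0 : (0 <= \int[mu]_(t in `[0%R, (2 * pi)%R]) ((g (circle r t)) ^+ 2)%:E)%E.
  by apply: integral_ge0 => t _; rewrite lee_fin sqr_ge0.
rewrite ltey; apply/eqP => e; move: fg.
by rewrite [X in (_ * X)%E]e gt0_muley ?lte_fin// ltxx.
Qed.

Lemma sqcvg_ereal (phi : nat -> R * R -> R) w :
  (forall n, dsqint (phi n)) -> dsqint w ->
  L2sq (disk r) (phi n \- w) @[n --> \oo] --> 0%E -> dsqcvg phi w.
Proof.
move=> sphi sw h.
have h' : fine (L2sq (disk r) (phi n \- w)) @[n --> \oo] --> (0 : R).
  exact: (fine_cvg (a := 0) h).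
refine (eq_cvg_fun _ h') => n.
by rewrite L2sqE//; exact: sqintB.
Qed.

Lemma csqcvg_ereal (phi : nat -> R * R -> R) g :
  (forall n, csqint (phi n)) -> csqint g ->
  bL2sq r (phi n \- g) @[n --> \oo] --> 0%E -> csqcvg phi g.
Proof.
move=> sphi sg h.
have h' : fine (bL2sq r (phi n \- g)) @[n --> \oo] --> (0 : R).
  exact: (fine_cvg (a := 0) h).
have := @cvg_scale _ r^-1 _ _ h'; rewrite mulr0 => h''.
refine (eq_cvg_fun _ h'') => n.
rewrite bL2sqE; last exact: (sqintB mC (sphi n) sg).
by rewrite /= mulrA mulVf ?mul1r// gt_eqF.
Qed.

End TracedFunctions.

(** * Weak derivatives *)

Section WeakPartials.
Context {R : realType}.
Implicit Types (U : set (R * R)) (u v w phi : R * R -> R) (s : axis).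

(** Near a point outside the support the function is constantly 0, and so is its
    derivative: supports do not grow. *)
Lemma test_function_partial U phi s : test_function U phi ->
  test_function U (partial [:: s] phi).
Proof.
move=> [sphi cK KU].
have sub : closure [set p | partial [:: s] phi p != 0] `<=`
    closure [set p | phi p != 0].
  rewrite [X in _ `<=` X]((closure_id _).1 (@closed_closure _ _)).
  apply: closureS => p; apply: contra_neqP => np.
  have oN : nbhs p (~` closure [set q | phi q != 0]).
    by apply: open_nbhs_nbhs; split => //; exact/closed_openC/closed_closure.
  have e : \forall q \near p, cst 0 q = phi q.
    apply: filterS oN => q /= nq; apply/esym/eqP/negPn/negP => hq.
    by apply: nq; exact: subset_closure.
  have := near_eq_is_derive e (is_derive_cst (0 : R) p (axis_vec R s)).
  by case=> _ <-.
split; first exact: smooth_partial.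
- by apply: (subclosed_compact _ cK) => //; exact: closed_closure.
- exact: subset_trans KU.
Qed.

Lemma wpartialP U (s : seq axis) u :
  (exists v, inL2 U v /\ is_weak_partial U s u v) ->
  inL2 U (wpartial U s u) /\ is_weak_partial U s u (wpartial U s u).
Proof.
by move=> h; apply: (@xgetPex _ (cst 0)
  [set v | inL2 U v /\ is_weak_partial U s u v]).
Qed.

Lemma sobolev_wpartial U k (s : seq axis) u : sobolev U k u -> (size s <= k)%N ->
  inL2 U (wpartial U s u) /\ is_weak_partial U s u (wpartial U s u).
Proof. by move=> [_ h] sk; apply: wpartialP; exact: h. Qed.

(** The outer derivative can be moved from the test function to [u], because a
    derivative of a test function is again a test function. *)
Lemma is_weak_partial_cons U s s' u w v : is_weak_partial U [:: s] u w ->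
  is_weak_partial U [:: s; s'] u v <-> is_weak_partial U [:: s'] w v.
Proof.
move=> h; split=> hv phi tphi; have := hv phi tphi;
  have := h _ (test_function_partial s' tphi);
  rewrite /= !expr1 ?expr2 !mulN1r ?opprK ?mul1r => h1.
  by rewrite [X in X = _ -> _]h1 => <-; rewrite opprK.
by move=> h2; rewrite [LHS]h1 -[RHS]opprK -h2.
Qed.

(** Both sides choose a representative from the same set of candidates, hence the
    same one: the equality holds everywhere and not only almost everywhere. *)
Lemma wpartial_cons U s s' u : sobolev U 1 u ->
  wpartial U [:: s; s'] u = wpartial U [:: s'] (wpartial U [:: s] u).
Proof.
move=> su; have [_ h] := sobolev_wpartial (s := [:: s]) su isT.
rewrite /wpartial; congr xget; apply/seteqP; split => v /= [iv wv]; split => //.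
  by apply/(is_weak_partial_cons _ _ h).
by apply/(is_weak_partial_cons _ _ h).
Qed.

End WeakPartials.

(** * Differentiating the equation *)

Section WeakHelmholtz.
Context {R : realType}.
Local Notation mu := (@lebesgue_measure R).
Variable r : R.
Hypothesis r0 : 0 < r.
Implicit Types (u v w phi f g : R * R -> R) (s : axis).

Local Notation dip := (ip (leb2 R) (disk r)).
Local Notation dsqint := (sqint (leb2 R) (disk r)).
Local Notation dsqeq := (sqeq (leb2 R) (disk r)).
Local Notation weak s := (is_weak_partial (disk r) [:: s]).

Let mD : measurable (disk r : set (measurableTypeR R * measurableTypeR R)).
Proof. exact: measurable_disk. Qed.

Definition smooth_limit f : Prop :=
  dsqint f /\ exists2 phi : nat -> R * R -> R,
    forall n, smooth (phi n) & sqcvg (leb2 R) (disk r) phi f.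

Lemma smooth_limitD f g : smooth_limit f -> smooth_limit g ->
  smooth_limit (fun p => f p + g p).
Proof.
move=> [sf [a sa ca]] [sg [b sb cb]]; split; first exact: sqintD.
exists (fun n p => a n p + b n p); first by move=> n; exact: smoothD.
by apply: (sqcvgD mD _ _ sf sg ca cb) => n; exact: smooth_dsqint.
Qed.

Lemma smooth_limitZ k f : smooth_limit f -> smooth_limit (fun p => k * f p).
Proof.
move=> [sf [a sa ca]]; split; first exact: sqintZ.
exists (fun n p => k * a n p); first by move=> n; exact: smoothZ.
by apply: (sqcvgZ mD k _ sf ca) => n; exact: smooth_dsqint.
Qed.

Lemma test_dsqint phi : test_function (disk r) phi -> dsqint phi.
Proof. by case=> sphi _ _; exact: smooth_dsqint. Qed.

(** The difference is weakly null and is a limit of smooth functions, so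
    [weakly_null_null] applies to it. *)
Lemma weak_eq_sqeq f g : smooth_limit f -> smooth_limit g ->
  (forall phi, test_function (disk r) phi -> dip f phi = dip g phi) ->
  dsqeq f g.
Proof.
move=> lf lg h; have [sE [z sz zE]] := smooth_limitD lf (smooth_limitZ (-1) lg).
have e : (fun p => f p + -1 * g p) = (fun p => f p - g p).
  by apply/funext => p; rewrite mulN1r.
rewrite e in sE zE; apply: (weakly_null_null r0 sE _ sz zE) => phi tphi.
have [sf _] := lf; have [sg _] := lg.
change (dip (fun p => f p - g p) phi = 0).
by rewrite ipBl// ?h ?subrr//; exact: test_dsqint.
Qed.

Lemma weak_ip s u v phi : weak s u v -> test_function (disk r) phi ->
  dip v phi = - dip u (partial [:: s] phi).
Proof.
move=> h tphi; have := h _ tphi; rewrite expr1 mulN1r => e.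
by rewrite /ip e opprK.
Qed.

Lemma weak_ip2 s s' u v w phi : weak s u v -> weak s' v w ->
  test_function (disk r) phi -> dip w phi = dip u (partial [:: s; s'] phi).
Proof.
move=> h h' tphi; rewrite (weak_ip h' tphi).
by rewrite (weak_ip h (test_function_partial s' tphi)) opprK.
Qed.

(** Two transpositions of neighbours in the word of derivatives. *)
Lemma partial_cycle s s' phi : smooth phi ->
  partial [:: s; s'; s'] phi = partial [:: s'; s'; s] phi.
Proof.
move=> sphi.
rewrite -[LHS]/(partial [:: s; s'] (partial [:: s'] phi)).
rewrite partial_commute; last exact: smooth_partial.
rewrite -[LHS]/(partial [:: s'] (partial [:: s; s'] phi)).
by rewrite (partial_commute s s' sphi).
Qed.

(** Differentiating the equation.  All derivatives are moved to the test function,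
    where they commute, and the equation for [u] is then tested with the
    derivative of [phi]. *)
Lemma weak_laplacian_partial (c : R) s u us ux uy uxx uyy usx usy usxx usyy :
  weak s u us -> weak ax_x u ux -> weak ax_y u uy ->
  weak ax_x ux uxx -> weak ax_y uy uyy -> weak ax_x us usx -> weak ax_y us usy ->
  weak ax_x usx usxx -> weak ax_y usy usyy ->
  dsqint u -> dsqint us -> dsqint uxx -> dsqint uyy ->
  dsqint usxx -> dsqint usyy ->
  dsqeq (fun p => uxx p + uyy p) (fun p => c * u p) ->
  forall phi, test_function (disk r) phi ->
  dip (fun p => usxx p + usyy p) phi = dip (fun p => c * us p) phi.
Proof.
move=> hs hx hy hxx hyy hsx hsy hsxx hsyy su sus suxx suyy susxx susyy H phi tphi.
have tp := test_function_partial s tphi.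
have tpxx := test_function_partial ax_x (test_function_partial ax_x tphi).
have tpyy := test_function_partial ax_y (test_function_partial ax_y tphi).
have sphi := test_dsqint tphi; have stp := test_dsqint tp.
have [smphi _ _] := tphi.
have e1 := ip_sqeq mD (sqintD mD suxx suyy) (sqintZ mD c su) stp H.
rewrite ipDl// ipZl// (weak_ip2 hx hxx tp) (weak_ip2 hy hyy tp) in e1.
have e2 := etrans (weak_ip2 hsx hsxx tphi) (weak_ip hs tpxx).
have e3 := etrans (weak_ip2 hsy hsyy tphi) (weak_ip hs tpyy).
apply: (etrans (ipDl mD susxx susyy sphi)); apply: (etrans (congr2 +%R e2 e3)).
apply: (etrans _ (esym (ipZl mD c sus sphi))).
apply: (etrans _ (esym (congr1 ( *%R c) (weak_ip hs tphi)))).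
apply: (etrans (esym (opprD _ _))); apply: (etrans _ (esym (mulrN _ _))).
apply: (congr1 -%R); apply: etrans e1.
have cx := congr1 (dip u) (partial_cycle s ax_x smphi).
have cy := congr1 (dip u) (partial_cycle s ax_y smphi).
exact: (congr2 +%R cx cy).
Qed.

End WeakHelmholtz.

(** * Energy estimates *)

(** Algebra of the final estimate.  Young's inequality is used with
    e = C2 / CO, so that by the trace inequality the terms e * T sum to
    at most C2 times the sum S of the three squared H^1 norms.  Twice the energy
    is at least 2 C2 S, half of which absorbs them.  This gives the constant
    CO / C2^2, and 1 <= CO bounds it by the square. *)
Lemma absorption_bound (R : realFieldType) (alpha2 C2 CO N P Q PX PY QX QY : R)
    (I1 I2 I3 T1 T2 T3 B1 B2 B3 : R) :
  0 < C2 -> C2 <= 1 -> C2 <= alpha2 -> 1 <= CO ->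
  0 <= N -> 0 <= P -> 0 <= Q -> 0 <= PX -> 0 <= PY -> 0 <= QX -> 0 <= QY ->
  0 <= B1 -> 0 <= B2 -> 0 <= B3 ->
  alpha2 * N + P + Q = I1 -> alpha2 * P + PX + PY = I2 ->
  alpha2 * Q + QX + QY = I3 ->
  (forall e, 0 < e -> I1 *+ 2 <= e * T1 + e^-1 * B1) ->
  (forall e, 0 < e -> I2 *+ 2 <= e * T2 + e^-1 * B2) ->
  (forall e, 0 < e -> I3 *+ 2 <= e * T3 + e^-1 * B3) ->
  T1 <= CO * (N + P + Q) -> T2 <= CO * (P + PX + PY) ->
  T3 <= CO * (Q + QX + QY) ->
  PX + QY + PY + (P + Q) + N <= CO ^+ 2 / C2 ^+ 2 * (B1 + B2 + B3).
Proof.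
move=> C0 C1 Ca O1 N0 P0 Q0 PX0 PY0 QX0 QY0 B10 B20 B30 E1 E2 E3 Y1 Y2 Y3 R1 R2 R3.
have O0 : 0 < CO by lra.
have e0 : 0 < C2 / CO by rewrite divr_gt0.
have := Y1 _ e0; have := Y2 _ e0; have := Y3 _ e0; rewrite invf_div => {Y1 Y2 Y3}.
have Z T S : T <= CO * S -> C2 / CO * T <= C2 * S.
  move=> h; apply: le_trans (ler_wpM2l (ltW e0) h) _.
  by rewrite mulrA divfK// gt_eqF.
move=> Y3 Y2 Y1; have := Z _ _ R1; have := Z _ _ R2; have := Z _ _ R3.
move=> {}R3 {}R2 {}R1.
set S := N + (P + Q) *+ 2 + PX + PY + QX + QY.
set B := B1 + B2 + B3.
have B0 : 0 <= B by rewrite !addr_ge0.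
have hS : C2 * S <= I1 + I2 + I3.
  by rewrite -E1 -E2 -E3 /S; nra.
have h : C2 * S <= CO / C2 * B by rewrite /S /B in hS *; lra.
have hS' : S <= CO / C2 ^+ 2 * B.
  rewrite -(ler_pM2l C0); apply: le_trans h _.
  by rewrite le_eqVlt; apply/orP; left; apply/eqP; field; rewrite gt_eqF.
have hC : CO / C2 ^+ 2 * B <= CO ^+ 2 / C2 ^+ 2 * B.
  apply: ler_wpM2r => //; apply: ler_wpM2r.
    by rewrite invr_ge0 exprn_ge0// ltW.
  by rewrite expr2 ler_peMl// ltW.
apply: le_trans (le_trans hS' hC); rewrite /S; lra.
Qed.

Lemma young_ip d (T : measurableType d) (R : realType)
    (mu : {measure set T -> \bar R}) (D : set T) (mD : measurable D)
    (f g : T -> R) (e : R) : sqint mu D f -> sqint mu D g -> 0 < e ->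
  ip mu D f g *+ 2 <= e * ip mu D f f + e^-1 * ip mu D g g.
Proof.
move=> sf sg e0; have := ip_ge0 mu D (fun x => f x + - e^-1 * g x).
rewrite ip_expand// => h; have := mulr_ge0 (ltW e0) h.
have -> : e * (ip mu D f f + - e^-1 * ip mu D f g *+ 2 + (- e^-1) ^+ 2 * ip mu D g g)
  = e * ip mu D f f + e^-1 * ip mu D g g - ip mu D f g *+ 2.
  by field; rewrite gt_eqF.
by rewrite subr_ge0.
Qed.

Section Assembly.
Context {R : realType}.
Local Notation mu := (@lebesgue_measure R).
Variable r : R.
Hypothesis r0 : 0 < r.
Implicit Types (u v w phi f g : R * R -> R) (s : axis).

Local Notation dip := (ip (leb2 R) (disk r)).
Local Notation dsqint := (sqint (leb2 R) (disk r)).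
Local Notation dsqeq := (sqeq (leb2 R) (disk r)).
Local Notation weak s := (is_weak_partial (disk r) [:: s]).
Local Notation csqint g := (sqint mu `[0, 2 * pi] (g \o circle r)).

Let mD : measurable (disk r : set (measurableTypeR R * measurableTypeR R)).
Proof. exact: measurable_disk. Qed.

Let mC : measurable (`[0, 2 * pi]%classic : set (measurableTypeR R)).
Proof. exact: measurable_itv. Qed.

Lemma h1_trace_smooth_limit w wx wy g : h1_trace r w wx wy g ->
  [/\ smooth_limit r w, smooth_limit r wx & smooth_limit r wy].
Proof.
move=> [sw swx swy _ [phi [ss c cx cy _]]].
split; split; [exact: sw| |exact: swx| |exact: swy|].
- by exists phi.
- exists (fun n => partial [:: ax_x] (phi n)); last exact: cx.
  by move=> n; exact: smooth_partial.
- exists (fun n => partial [:: ax_y] (phi n)); last exact: cy.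
  by move=> n; exact: smooth_partial.
Qed.

Lemma is_trace_h1_trace w g : is_trace r w g ->
  [/\ h1_trace r w (wpartial (disk r) [:: ax_x] w) (wpartial (disk r) [:: ax_y] w) g,
      weak ax_x w (wpartial (disk r) [:: ax_x] w) &
      weak ax_y w (wpartial (disk r) [:: ax_y] w)].
Proof.
move=> [sw /(inbL2_csqint r0) sg [phi [ss c cd cg]]].
have [iw _] := sw.
have [ix hx] := sobolev_wpartial (s := [:: ax_x]) sw isT.
have [iy hy] := sobolev_wpartial (s := [:: ax_y]) sw isT.
have sm n := smooth_dsqint r0 (ss n).
have smp a n := smooth_dsqint r0 (smooth_partial a (ss n)).
split; [|exact: hx|exact: hy].
split; [exact: iw|exact: ix|exact: iy|exact: sg|exists phi].
split; first exact: ss.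
- exact: sqcvg_ereal sm iw c.
- exact: sqcvg_ereal (smp ax_x) ix (cd ax_x).
- exact: sqcvg_ereal (smp ax_y) iy (cd ax_y).
- by apply: (csqcvg_ereal r0 _ sg cg) => n; exact: smooth_csqint.
Qed.

(** The trace of u itself comes from u = (u_xx + u_yy) / c.  The derivatives along
    [s] of the smooth functions that approximate the right side converge to
    (vx + vy) / c, and this combination is a weak derivative of u. *)
Lemma weak_partial_recovery (c : R) s u us uxx uyy vx vy :
  c != 0 -> weak s u us -> weak s uxx vx -> weak s uyy vy ->
  dsqint u -> smooth_limit r uxx -> smooth_limit r uyy ->
  smooth_limit r us -> smooth_limit r vx -> smooth_limit r vy ->
  dsqeq (fun p => uxx p + uyy p) (fun p => c * u p) ->
  dsqeq (fun p => c^-1 * (vx p + vy p)) us.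
Proof.
move=> c0 hs hx hy su [suxx _] [suyy _] lus lvx lvy H.
apply: (weak_eq_sqeq r0 (smooth_limitZ r0 _ (smooth_limitD r0 lvx lvy)) lus).
have [svx _] := lvx; have [svy _] := lvy.
move=> phi tphi; have tp := test_function_partial s tphi.
have sphi := test_dsqint r0 tphi; have stp := test_dsqint r0 tp.
have e1 := ip_sqeq mD (sqintD mD suxx suyy) (sqintZ mD c su) stp H.
have e2 := etrans (esym (ipDl mD suxx suyy stp)) e1.
have e3 := etrans e2 (ipZl mD c su stp).
apply: (etrans (ipZl mD _ (sqintD mD svx svy) sphi)).
apply: (etrans (congr1 ( *%R c^-1) (ipDl mD svx svy sphi))).
apply: (etrans (congr1 ( *%R c^-1)
  (congr2 +%R (weak_ip hx tphi) (weak_ip hy tphi)))).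
apply: (etrans (congr1 ( *%R c^-1) (esym (opprD _ _)))).
apply: (etrans (congr1 ( *%R c^-1) (congr1 -%R e3))).
apply: (etrans _ (esym (weak_ip hs tphi))).
by rewrite mulrN mulKf.
Qed.

End Assembly.

Section EnergyBound.
Context {R : realType}.
Local Notation mu := (@lebesgue_measure R).
Variable r : R.
Hypothesis r0 : 0 < r.
Implicit Types (u v w phi f g : R * R -> R) (s : axis).

Local Notation dip := (ip (leb2 R) (disk r)).
Local Notation cip := (cip r).
Local Notation dsqint := (sqint (leb2 R) (disk r)).
Local Notation dsqeq := (sqeq (leb2 R) (disk r)).
Local Notation weak s := (is_weak_partial (disk r) [:: s]).
Local Notation csqint g := (sqint mu `[0, 2 * pi] (g \o circle r)).

Let mD : measurable (disk r : set (measurableTypeR R * measurableTypeR R)).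
Proof. exact: measurable_disk. Qed.

Let mC : measurable (`[0, 2 * pi]%classic : set (measurableTypeR R)).
Proof. exact: measurable_itv. Qed.

(** Green's identity for the field (a, b) = grad w, whose divergence is c w by
    the equation. *)
Lemma energy_identity (c : R) w wx wy gw a a_x a_y ga b b_x b_y gb :
  h1_trace r w wx wy gw -> h1_trace r a a_x a_y ga -> h1_trace r b b_x b_y gb ->
  dsqeq wx a -> dsqeq wy b -> dsqeq (fun p => a_x p + b_y p) (fun p => c * w p) ->
  c * dip w w + dip a a + dip b b = r * cip gw (normal_part r ga gb).
Proof.
move=> Tw Ta Tb ea eb ec; have G := green_traced r0 Tw Ta Tb; rewrite -G {G}.
have [sw swx swy _ _] := Tw; have [sa sax say _ _] := Ta.
have [sb sbx sby _ _] := Tb.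
have e1 := ip_sqeq mD (sqintD mD sax sby) (sqintZ mD c sw) sw ec.
have e2 := etrans (esym (ipDl mD sax sby sw)) (etrans e1 (ipZl mD c sw sw)).
have e3 := ip_sqeq mD swx sa sa ea; have e4 := ip_sqeq mD swy sb sb eb.
apply: (etrans (congr2 +%R (congr2 +%R (esym e2) (esym e3)) (esym e4))).
apply: (etrans (congr2 +%R (congr2 +%R
  (congr2 +%R (ipC _ _ _ _) (ipC _ _ _ _)) erefl) erefl)).
move: (dip w a_x) (dip w b_y) (dip wx a) (dip wy b) => A B C E.
by rewrite -!addrA; congr (_ + _); rewrite addrCA.
Qed.

(** The energy identity is applied to u, u_x and u_y.  For u the function [U]
    below stands in: it is equal to u almost everywhere and has the trace that
    is built from those of the second derivatives. *)
Lemma energy_bound (c C2 : R) u p q pxx pxy qx qy t1 t2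
    pxxx pxxy pxyx pxyy qxx qxy qyx qyy t3 t4 t5 t6 :
  0 < C2 -> C2 <= 1 -> C2 <= c ->
  dsqint u -> weak ax_x u p -> weak ax_y u q ->
  weak ax_x p pxx -> weak ax_y p pxy -> weak ax_x q qx -> weak ax_y q qy ->
  weak ax_x pxx pxxx -> weak ax_y pxx pxxy -> weak ax_y pxy pxyy ->
  weak ax_x qx qxx -> weak ax_x qy qyx -> weak ax_y qy qyy ->
  h1_trace r p pxx pxy t1 -> h1_trace r q qx qy t2 ->
  h1_trace r pxx pxxx pxxy t3 -> h1_trace r pxy pxyx pxyy t4 ->
  h1_trace r qx qxx qxy t5 -> h1_trace r qy qyx qyy t6 ->
  {ae leb2 R, forall z, disk r z -> pxx z + qy z = c * u z} ->
  dip pxx pxx + dip qy qy + dip pxy pxy + (dip p p + dip q q) + dip u u <=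
  (1 + 2 / r) ^+ 2 / C2 ^+ 2 *
   (r * cip (normal_part r t1 t2) (normal_part r t1 t2) +
    r * cip (normal_part r t3 t4) (normal_part r t3 t4) +
    r * cip (normal_part r t5 t6) (normal_part r t5 t6)).
Proof.
move=> C0 C1 Cc su wup wuq wpx wpy wqx wqy wpxx wpxxy wpxyy wqxx wqyx wqyy.
move=> Tp Tq Tpxx Tpxy Tqx Tqy helm.
have c0 : c != 0 by rewrite gt_eqF// (lt_le_trans C0).
have [lp lpxx lpxy] := h1_trace_smooth_limit Tp.
have [lq lqx lqy] := h1_trace_smooth_limit Tq.
have [_ lpxxx lpxxy] := h1_trace_smooth_limit Tpxx.
have [_ lpxyx lpxyy] := h1_trace_smooth_limit Tpxy.
have [_ lqxx lqxy] := h1_trace_smooth_limit Tqx.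
have [_ lqyx lqyy] := h1_trace_smooth_limit Tqy.
have [sp spxx spxy st1 _] := Tp; have [sq sqx sqy st2 _] := Tq.
have [_ spxxx spxxy st3 _] := Tpxx; have [_ spxyx spxyy st4 _] := Tpxy.
have [_ sqxx sqxy st5 _] := Tqx; have [_ sqyx sqyy st6 _] := Tqy.
have H : dsqeq (fun z => pxx z + qy z) (fun z => c * u z).
  exact: (sqeq_ae mD (sqintD mD spxx sqy) (sqintZ mD c su) helm).
have TU := h1_traceZ r0 c^-1 (h1_traceD r0 Tpxx Tqy).
set U := (fun z => c^-1 * (pxx z + qy z)) in TU.
have sU : dsqint U by case: TU.
have [_ _ _ st0 _] := TU.
have HU : dsqeq U u.
  apply: (sqeq_ae mD sU su); apply: ae_imp helm => z h Dz.
  by rewrite /U h// mulKf.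
have ex := weak_partial_recovery r0 c0 wup wpxx wqyx su lpxx lqy lp lpxxx lqyx H.
have ey := weak_partial_recovery r0 c0 wuq wpxxy wqyy su lpxx lqy lq lpxxy lqyy H.
have HcU : dsqeq (fun z => pxx z + qy z) (fun z => c * U z).
  apply: (sqeq_ae mD (sqintD mD spxx sqy) (sqintZ mD c sU)).
  by apply: ae_imp helm => z h Dz; rewrite /U h// mulKf.
have lapl s us usx usy usxx usyy :
    weak s u us -> weak ax_x us usx -> weak ax_y us usy ->
    weak ax_x usx usxx -> weak ax_y usy usyy ->
    smooth_limit r us -> smooth_limit r usxx -> smooth_limit r usyy ->
    dsqeq (fun z => usxx z + usyy z) (fun z => c * us z).
  move=> h1 h2 h3 h4 h5 lus lxx lyy.
  apply: (weak_eq_sqeq r0 (smooth_limitD r0 lxx lyy) (smooth_limitZ r0 c lus)).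
  exact: (weak_laplacian_partial r0 h1 wup wuq wpx wqy h2 h3 h4 h5 su
    (proj1 lus) spxx sqy (proj1 lxx) (proj1 lyy) H).
have lapp := lapl _ _ _ _ _ _ wup wpx wpy wpxx wpxyy lp lpxxx lpxyy.
have lapq := lapl _ _ _ _ _ _ wuq wqx wqy wqxx wqyy lq lqxx lqyy.
have I1 := energy_identity TU Tp Tq ex ey HcU.
have I2 := energy_identity Tp Tpxx Tpxy
  (sqeq_refl (leb2 R) mD pxx) (sqeq_refl (leb2 R) mD pxy) lapp.
have I3 := energy_identity Tq Tqx Tqy
  (sqeq_refl (leb2 R) mD qx) (sqeq_refl (leb2 R) mD qy) lapq.
have R1 := trace_traced r0 TU; have R2 := trace_traced r0 Tp.
have R3 := trace_traced r0 Tq.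
have dUU := ip_sqeq_diag mD sU su HU.
have [_ sUx sUy _ _] := TU.
have dUx := ip_sqeq_diag mD sUx sp ex; have dUy := ip_sqeq_diag mD sUy sq ey.
have sg1 := csqint_normal_part r0 st1 st2.
have sg2 := csqint_normal_part r0 st3 st4.
have sg3 := csqint_normal_part r0 st5 st6.
have Y f g : csqint f -> csqint g -> forall e, 0 < e ->
    (r * cip f g) *+ 2 <= e * (r * cip f f) + e^-1 * (r * cip g g).
  move=> sf sg e e0; have h := young_ip mC sf sg e0.
  have := ler_wpM2l (ltW r0) h.
  by rewrite mulrnAr [leRHS]mulrDr (mulrCA r e) (mulrCA r e^-1).
have Y1 := Y _ _ st0 sg1; have Y2 := Y _ _ st1 sg2; have Y3 := Y _ _ st2 sg3.
have nn f : 0 <= dip f f by exact: ip_ge0.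
have cn f : 0 <= r * cip f f by apply: mulr_ge0; [exact: ltW|exact: ip_ge0].
have O1 : 1 <= 1 + 2 / r by rewrite lerDl divr_ge0// ltW.
have R1' := eq_ind _ (fun S => _ <= (1 + 2 / r) * S) R1 _
  (congr2 +%R (congr2 +%R dUU dUx) dUy).
have I1' := etrans (congr2 +%R (congr2 +%R
  (congr1 ( *%R c) (esym dUU)) erefl) erefl) I1.
exact: (absorption_bound C0 C1 Cc O1 (nn u) (nn p) (nn q) (nn pxx) (nn pxy) (nn qx)
  (nn qy) (cn _) (cn _) (cn _) I1' I2 I3 Y1 Y2 Y3 R1' R2 R3).
Qed.

End EnergyBound.

(* g, gx and gy are the normal derivatives of u, u_x and u_y on the circle. *)
Theorem lemma4p4 (R : realType) (alpha r : R) (u g gx gy : R * R -> R)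
    (halpha : 0 < alpha) (hr : 0 < r)
    (hu : sobolev (disk r) 3 u)
    (hhelm : helmholtz (disk r) alpha u)
    (hg : is_normal_derivative r u g)
    (hgx : is_normal_derivative r (wpartial (disk r) [:: ax_x] u) gx)
    (hgy : is_normal_derivative r (wpartial (disk r) [:: ax_y] u) gy) :
  (H2sq (disk r) u <=
   (C_3 alpha r)%:E * (bL2sq r g + bL2sq r gx + bL2sq r gy))%E.
Proof.
have su1 : sobolev (disk r) 1 u.
  by case: hu => iu h; split=> // s s1; apply: h; exact: leq_trans s1 _.
have [iu _] := su1.
have [_ wup] := sobolev_wpartial (s := [:: ax_x]) su1 isT.
have [_ wuq] := sobolev_wpartial (s := [:: ax_y]) su1 isT.
case: hg => t1 [t2 [T1 T2 eg]].
case: hgx => t3 [t4 [T3 T4 egx]].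
case: hgy => t5 [t6 [T5 T6 egy]].
have [Tp wpx wpy] := is_trace_h1_trace hr T1.
have [Tq wqx wqy] := is_trace_h1_trace hr T2.
have [Tpx wpxx wpxy] := is_trace_h1_trace hr T3.
have [Tpy _ wpyy] := is_trace_h1_trace hr T4.
have [Tqx wqxx _] := is_trace_h1_trace hr T5.
have [Tqy wqyx wqyy] := is_trace_h1_trace hr T6.
move: hhelm; rewrite /helmholtz /H2sq.
rewrite (wpartial_cons ax_x ax_x su1) (wpartial_cons ax_y ax_y su1).
rewrite (wpartial_cons ax_x ax_y su1) => hhelm.
have a0 : 0 < alpha ^+ 2 by rewrite exprn_gt0.
have C0 : 0 < C_2 alpha by rewrite /C_2 lt_min ltr01.
have C1 : C_2 alpha <= 1 by rewrite /C_2 ge_min lexx.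
have Ca : C_2 alpha <= alpha ^+ 2 by rewrite /C_2 ge_min lexx orbT.
have := energy_bound hr C0 C1 Ca iu wup wuq wpx wpy wqx wqy wpxx wpxy wpyy
  wqxx wqyx wqyy Tp Tq Tpx Tpy Tqx Tqy hhelm.
have [sp spx spy st1 _] := Tp; have [sq sqx sqy st2 _] := Tq.
have [_ _ _ st3 _] := Tpx; have [_ _ _ st4 _] := Tpy.
have [_ _ _ st5 _] := Tqx; have [_ _ _ st6 _] := Tqy.
have bE h a b : (forall p : R * R, p.1 ^+ 2 + p.2 ^+ 2 = r ^+ 2 ->
      h p = a p * (p.1 / r) + b p * (p.2 / r)) ->
    sqint (@lebesgue_measure R) `[0, 2 * pi] (a \o circle r) ->
    sqint (@lebesgue_measure R) `[0, 2 * pi] (b \o circle r) ->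
    bL2sq r h = (r * cip r (normal_part r a b) (normal_part r a b))%:E.
  move=> e sa sb; rewrite -(bL2sqE (csqint_normal_part hr sa sb)).
  rewrite /bL2sq; congr (_ * _)%E; apply: eq_integral => t _.
  rewrite e//= /circle/= !exprMn -mulrDr cos2Dsin2; exact: mulr1.
rewrite (bE _ _ _ eg st1 st2) (bE _ _ _ egx st3 st4) (bE _ _ _ egy st5 st6).
have e := congr2 adde (congr2 adde (congr2 adde (congr2 adde (L2sqE spx) (L2sqE sqy))
  (L2sqE spy)) (congr2 adde (L2sqE sp) (L2sqE sq))) (L2sqE iu).
move=> ineq; apply: (eq_ind_r (fun z => (z <= _)%E) _ e).
by rewrite -!EFinD -EFinM lee_fin.
Qed.
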